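(* Let $B>H\ge 3$ be integers and let $T$ be an ordinal tree with $n$ nodes. Then, in linear time, $T$ can be decomposed (via the tree-slabbing construction described in the context) into connected subtrees with the following properties: (i) subtrees are pairwise disjoint except for (potentially) sharing a common subtree root; (ii) every subtree has at most $M=2B$ nodes and height at most $H$; (iii) every subtree is either pure (a connected induced subgraph of $T$) or glued (a dummy root whose children are roots of connected induced subgraphs of $T$); (iv) every subtree is either a skinny (slab) subtree, consisting of an entire slab, or fat; (v) the overall number of subtrees is $O(n/H)$, of which $O(n/B)$ are fat; (vi) every connection between two subtrees $\mu$ and $\mu'$ is of one of the following types: (1) $\mu$ and $\mu'$ share a common root, and each subtree contains at most two blocks of consecutive children of a shared root; (2) the root of $\mu'$ is a child of the root of $\mu$; (3) the root of $\mu'$ is a child of another (non-root) node of $\mu$, which happens for at most one such edge per subtree $\mu$; (4) $\mu'$ contains the original copy of a promoted s-node of $\mu$, and the total number of connections of this type is $O(n/H)$.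
   Context: An ordinal tree is a rooted tree whose children are ordered. Tree-slabbing construction with parameters $H$ (slab height) and $B$ (block size): choose an offset $o\in\{1,\dots,H\}$ minimizing the total number of nodes at depths $o+jH$ ($j\ge 0$ integer); these nodes are called s-nodes (there are at most $n/H$ of them). The $i$th slab is $S_i=\{v:\mathrm{depth}(v)\in[(i-1)H+o,\,iH+o]\}$, so every s-node lies in two consecutive slabs: within a slab, the s-nodes on its top level are the (original) s-nodes and those on its bottom level are copies called promoted s-nodes. Each slab (a left-to-right ordered set of subtrees) is turned into a single tree by adding a dummy root whose children are the roots of those subtrees in left-to-right order. If a slab (with dummy root) has at most $B$ nodes it is kept as a single skinny subtree; otherwise it is a fat slab and is further decomposed by the Farzan–Munro tree-covering scheme with parameter $B$ (which splits a tree into connected subtrees of at most $2B$ nodes each, $\Theta(n/B)$ many, pairwise disjoint except for shared roots, each having at most one edge other than edges from its root leading outside it), the resulting pieces being the fat subtrees.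
   Formalization: In (ii) the height bound H does not count the dummy root of a glued subtree (a full slab with its dummy root has height H+1); in (v) the overall number of subtrees is O(max(1, n/H)), since one subtree remains even when n < H. *)

(* Defs.v *)
From HB Require Import structures.
From mathcomp Require Import all_boot.

Set Implicit Arguments.
Unset Strict Implicit.
Unset Printing Implicit Defensive.

(** * Ordinal trees *)

(** Every node carries a name; the names of the nodes of a tree are required to
    be distinct wherever this matters, so a node is identified with its name. *)
Inductive otree (A : Type) : Type := Node of A & seq (otree A).

Section OtreeEqType.
Variable A : Type.

Lemma otree_ind_seq (P : otree A -> Prop) :
  (forall a ts, foldr (fun t Q => P t /\ Q) True ts -> P (Node a ts)) ->
  forall t, P t.
Proof.
move=> IH; fix ih 1; case=> a ts; apply: IH.
by elim: ts => //= t ts IHts; split.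
Qed.

Fixpoint otree_encode (t : otree A) : GenTree.tree A :=
  let: Node a ts := t in
  GenTree.Node 0 (GenTree.Leaf a :: map otree_encode ts).

Fixpoint otree_decode (g : GenTree.tree A) : option (otree A) :=
  if g is GenTree.Node _ (GenTree.Leaf a :: gs) then
    Some (Node a (pmap otree_decode gs))
  else None.

Lemma otree_encodeK : pcancel otree_encode otree_decode.
Proof.
elim/otree_ind_seq => a ts IH /=; congr (Some (Node a _)).
by elim: ts IH => //= t ts IHts [-> /IHts ->].
Qed.
End OtreeEqType.

HB.instance Definition _ (A : eqType) :=
  Equality.copy (otree A) (pcan_type (@otree_encodeK A)).

Definition root (A : Type) (t : otree A) : A := let: Node a _ := t in a.
Definition kids (A : Type) (t : otree A) : seq (otree A) :=
  let: Node _ ts := t in ts.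

Fixpoint otree_map (A B : Type) (f : A -> B) (t : otree A) : otree B :=
  let: Node a ts := t in Node (f a) (map (otree_map f) ts).

(** Preorder. *)
Fixpoint nodes (A : Type) (t : otree A) : seq A :=
  let: Node a ts := t in a :: flatten (map (@nodes A) ts).

Definition num_nodes (A : Type) (t : otree A) : nat := size (nodes t).

(** Height counted in edges. *)
Fixpoint height (A : Type) (t : otree A) : nat :=
  let: Node _ ts := t in
  foldr maxn 0 (map (fun u => (height u).+1) ts).

(** The children of the node named [x], from left to right. *)
Fixpoint children (A : eqType) (t : otree A) (x : A) : seq A :=
  let: Node a ts := t in
  if a == x then map (@root A) ts
  else flatten (map (fun u => children u x) ts).

Definition edge (A : eqType) (t : otree A) (x y : A) : bool :=
  y \in children t x.

(** [p] is a connected induced subgraph of [t] with the order inherited from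
    [t]; connectedness is built in, since [p] is itself a tree. *)
Definition induced_subtree (A : eqType) (p t : otree A) : Prop :=
  subseq (nodes p) (nodes t) /\
  {in nodes p &, forall x y, edge p x y = edge t x y}.

(** The forest induced by the nodes of [t] whose depth lies in [[lo, hi]], in
    left-to-right order, where the root of [t] is taken to have depth [d]. *)
Fixpoint band (A : Type) (lo hi d : nat) (t : otree A) : seq (otree A) :=
  let: Node a ts := t in
  let f := flatten (map (band lo hi d.+1) ts) in
  if lo <= d <= hi then [:: Node a f] else f.

(** The nodes at depth [d]; the root has depth 0. *)
Definition level (A : Type) (t : otree A) (d : nat) : seq A :=
  flatten (map (@nodes A) (band d d 0 t)).

(** * Slabs *)

(** The number of nodes at the depths [o + j * H]; values [j >= num_nodes T]
    contribute nothing when [0 < H]. *)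
Definition snodes (T : otree nat) (H o : nat) : nat :=
  \sum_(j < num_nodes T) size (level T (o + j * H)).

(** The depths of slab [i] range over [[(i - 1) * H + o, i * H + o]]. For
    [i = 0] the lower end is negative and truncates to 0 (given [o <= H]). *)
Definition slab_forest (T : otree nat) (H o i : nat) : seq (otree nat) :=
  band (i * H + o - H) (i * H + o) 0 T.

(** The dummy root is [None]; a node [v] of [T] is [Some v]. *)
Definition slab_tree (T : otree nat) (H o i : nat) : otree (option nat) :=
  Node None (map (otree_map Some) (slab_forest T H o i)).

(** A subtree of the decomposition: the index of its slab, whether it is fat,
    and the tree itself. *)
Definition piece : Type := (nat * bool * otree (option nat))%type.
Definition slab (mu : piece) : nat := mu.1.1.
Definition fat (mu : piece) : bool := mu.1.2.
Definition ptree (mu : piece) : otree (option nat) := mu.2.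

(** Nodes of the decomposition are occurrences [(i, x)] of [x] in slab [i], so
    that the two copies of an s-node, in consecutive slabs, are different. *)
Definition copy : Type := (nat * option nat)%type.
Definition copies (mu : piece) : seq copy :=
  [seq (slab mu, x) | x <- nodes (ptree mu)].
Definition proot (mu : piece) : copy := (slab mu, root (ptree mu)).

Definition glued (mu : piece) : bool := root (ptree mu) == None.

(** The parts of [mu] made of nodes of [T] only, when [None] occurs at most at
    the root. *)
Definition components (mu : piece) : seq (otree (option nat)) :=
  if glued mu then kids (ptree mu) else [:: ptree mu].

(** * The slabbing construction *)

(** The guarantees of the Farzan-Munro tree covering of [S] with parameter [B];
    the bounds on [size ps] say that it is Theta(num_nodes S / B), with constant
    [C]. *)
Definition tree_cover (A : eqType) (C B : nat) (S : otree A)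
    (ps : seq (otree A)) : Prop :=
  [/\ {in ps, forall p, induced_subtree p S /\ num_nodes p <= 2 * B},
      {in nodes S, forall x, exists2 p, p \in ps & x \in nodes p},
      size ps * B <= C * num_nodes S /\ num_nodes S <= C * (size ps * B),
      {in ps &, forall p q, p != q ->
        forall x, x \in nodes p -> x \in nodes q -> x = root p /\ x = root q} &
      {in ps, forall p x y x' y',
        x \in nodes p -> x != root p -> y \notin nodes p -> edge S x y ->
        x' \in nodes p -> x' != root p -> y' \notin nodes p -> edge S x' y' ->
        (x, y) = (x', y')}].

Definition slabbing (C H B : nat) (T : otree nat) (o : nat) (D : seq piece) :
    Prop :=
  [/\ 0 < o <= H /\
        (forall o', 0 < o' <= H -> snodes T H o <= snodes T H o'),
      uniq D,
      {in D, forall mu, slab_forest T H o (slab mu) <> [::]} &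
      forall i, slab_forest T H o i <> [::] ->
        let S := slab_tree T H o i in
        let Di := [seq mu <- D | slab mu == i] in
        if num_nodes S <= B then Di = [:: (i, false, S)]
        else all fat Di /\ tree_cover C B S [seq ptree mu | mu <- Di]].

(** * Connections between subtrees *)

Section Connections.
Variables (T : otree nat) (H o : nat).

Definition slab_edge (x y : copy) : bool :=
  (x.1 == y.1) && edge (slab_tree T H o x.1) x.2 y.2.

(** [x] is on the bottom level of its slab and is an s-node. *)
Definition promoted (x : copy) : bool :=
  if x.2 is Some v then v \in level T (x.1 * H + o) else false.

Definition original_of (x y : copy) : bool :=
  promoted x && (y == (x.1.+1, x.2)).

(** A connection between two subtrees goes from a node [x] of the first to a
    node [y] of the second with [connected x y]. *)
Definition connected (x y : copy) : bool :=
  [|| x == y, slab_edge x y | original_of x y].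

Definition shared_root (mu nu : piece) (x : copy) : bool :=
  (x == proot mu) && (x == proot nu).

Definition root_child (mu nu : piece) (x y : copy) : bool :=
  [&& x == proot mu, y == proot nu & slab_edge x y].

Definition inner_child (mu nu : piece) (x y : copy) : bool :=
  [&& x \in copies mu, x != proot mu, y == proot nu & slab_edge x y].

Definition promotion (mu nu : piece) (x y : copy) : bool :=
  [&& x \in copies mu, y \in copies nu & original_of x y].

(** The number of connections by promotion, over all pairs of subtrees. *)
Definition promotions (D : seq piece) : nat :=
  \sum_(mu <- D) \sum_(nu <- D)
    count (fun x => promotion mu nu x (x.1.+1, x.2)) (copies mu).

(** The number of maximal runs of [true]. *)
Fixpoint blocks (prev : bool) (s : seq bool) : nat :=
  if s is b :: s' then (~~ prev && b) + blocks b s' else 0.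

(** The number of blocks of consecutive children of the root of [mu] (within its
    slab) that belong to [mu]. *)
Definition root_blocks (mu : piece) : nat :=
  blocks false [seq x \in nodes (ptree mu)
               | x <- children (slab_tree T H o (slab mu)) (root (ptree mu))].
End Connections.

(** * Cost model *)

(** A first-order functional language over numbers and pairs, with call by
    value. Every step is a constant-time operation of a pointer machine or a
    word RAM. The only arithmetic is successor and truncated subtraction, so
    after [k] steps no number exceeds the largest number in the input or the
    program by more than [k]; words of logarithmic size suffice. *)
Inductive val : Type := Num of nat | Pair of val & val.

Inductive exp : Type :=
| EVar of nat
| ENum of nat
| ESucc of exp
| ESub of exp & exp
| EPair of exp & exp
| EFst of exp
| ESnd of exp
| EIfz of exp & exp & exp
| ELet of exp & exp
| ECall of nat & exp.

(** The bodies of mutually recursive functions; each has one parameter, which is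
    variable 0 (variables are de Bruijn indices), and is called by its
    position. *)
Definition program : Type := seq exp.

(** [eval P env e v k]: in the environment [env], the expression [e] evaluates
    to [v] in [k] steps. [EIfz] selects its first branch on [Num 0] only. *)
Inductive eval (P : program) : seq val -> exp -> val -> nat -> Prop :=
| eval_var env i : i < size env ->
    eval P env (EVar i) (nth (Num 0) env i) 1
| eval_num env n :
    eval P env (ENum n) (Num n) 1
| eval_succ env e n k :
    eval P env e (Num n) k -> eval P env (ESucc e) (Num n.+1) k.+1
| eval_sub env e1 e2 m n k1 k2 :
    eval P env e1 (Num m) k1 -> eval P env e2 (Num n) k2 ->
    eval P env (ESub e1 e2) (Num (m - n)) (k1 + k2).+1
| eval_pair env e1 e2 v1 v2 k1 k2 :
    eval P env e1 v1 k1 -> eval P env e2 v2 k2 ->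
    eval P env (EPair e1 e2) (Pair v1 v2) (k1 + k2).+1
| eval_fst env e v1 v2 k :
    eval P env e (Pair v1 v2) k -> eval P env (EFst e) v1 k.+1
| eval_snd env e v1 v2 k :
    eval P env e (Pair v1 v2) k -> eval P env (ESnd e) v2 k.+1
| eval_ifz_zero env e e1 e2 v k k1 :
    eval P env e (Num 0) k -> eval P env e1 v k1 ->
    eval P env (EIfz e e1 e2) v (k + k1).+1
| eval_ifz_other env e e1 e2 u v k k2 :
    eval P env e u k -> u <> Num 0 -> eval P env e2 v k2 ->
    eval P env (EIfz e e1 e2) v (k + k2).+1
| eval_let env e1 e2 u v k1 k2 :
    eval P env e1 u k1 -> eval P (u :: env) e2 v k2 ->
    eval P env (ELet e1 e2) v (k1 + k2).+1
| eval_call env f e u v k1 k2 : f < size P ->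
    eval P env e u k1 -> eval P [:: u] (nth (ENum 0) P f) v k2 ->
    eval P env (ECall f e) v (k1 + k2).+1.

(** Execution starts by calling the first function on the input. *)
Definition runs (P : program) (input output : val) (k : nat) : Prop :=
  eval P [:: input] (ECall 0 (EVar 0)) output k.

Definition enc_seq (vs : seq val) : val := foldr Pair (Num 0) vs.

Fixpoint enc_tree (A : Type) (enc : A -> nat) (t : otree A) : val :=
  let: Node a ts := t in
  Pair (Num (enc a)) (enc_seq (map (enc_tree enc) ts)).

Definition enc_input (T : otree nat) (H B : nat) : val :=
  Pair (enc_tree id T) (Pair (Num H) (Num B)).

Definition enc_option (x : option nat) : nat :=
  if x is Some v then v.+1 else 0.

Definition enc_piece (mu : piece) : val :=
  Pair (Num (slab mu)) (Pair (Num (fat mu)) (enc_tree enc_option (ptree mu))).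

Definition enc_output (D : seq piece) : val := enc_seq (map enc_piece D).

(* Main.v *)
(** A tree is covered by scanning, at every node [v], the children of [v] from
    right to left, while a group of consecutive children is collected whose
    subtrees, joined below [v], have fewer than [B] nodes and at most one
    outgoing edge. When the size bound or the bound on outgoing edges is about
    to be violated, the group is detached as a piece with root [v]; then [v]
    becomes closed, that is, its parent sees an outgoing edge instead of a
    subtree to be merged. A piece thus leaves out at most one child within its
    range, which gives at most two blocks. The number of pieces is bounded by a
    potential: 6 per node of the current group, [3 * B] per closed node, and
    [2 * B] per outgoing edge of an open node.

    The offset minimizes the number of s-nodes by averaging over the residues
    modulo [H]. The program computes all residue sums in the form [n] minus the
    sum, so that subtractions suffice; for the same reason the scan keeps the
    remaining room of a group instead of its size. Every node is in at most two
    slabs, so processing the slabs from top to bottom takes linear time. *)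

From mathcomp Require Import all_boot zify.
Require Import Defs.

Set Implicit Arguments.
Unset Strict Implicit.
Unset Printing Implicit Defensive.

(** * Forests *)

Section Forests.
Variable A : Type.
Implicit Types (t u : otree A) (F G : seq (otree A)).

(** The covering theorem cannot serve as a black box. Its guarantees include neither the two blocks
    per shared root nor the distinctness of the pieces, and a program must produce the very same
    pieces. Hence the cover is a concrete recursive function whose results are sections of subtrees
    with at most one gap, and the potential only has to bound their number. Its constants follow
    from three payments: a full group must finance one piece and the closing of its root, a closed
    child its own last piece and an outgoing edge of its parent, and a child that forces a break
    whatever the broken group could not pay. Two further points need care. An original s-node may be
    a root shared by many pieces, so connections by promotion are charged partly to pieces and
    partly to s-nodes. And [H] is not bounded in terms of [n], so the search for the offset must not
    create a counter for each residue when the tree has fewer than [H] levels. *)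

Lemma forest_ind (Q : seq (otree A) -> Prop) :
  Q [::] -> (forall a ts us, Q ts -> Q us -> Q (Node a ts :: us)) ->
  forall F, Q F.
Proof.
move=> Q0 Qc; suff Qt t : forall us, Q us -> Q (t :: us).
  by elim=> // t F IH; exact: Qt.
elim/otree_ind_seq: t => a ts IH us Qus; apply: Qc => //.
by elim: ts IH => //= t ts IHts [Qt /IHts Qts]; exact: Qt.
Qed.

Definition fnodes F := flatten (map (@nodes A) F).
Definition fkids F := flatten (map (@kids A) F).
Definition fheight F := foldr maxn 0 (map (fun u => (height u).+1) F).

Lemma nodesE a ts : nodes (Node a ts) = a :: fnodes ts. Proof. by []. Qed.
Lemma nodes_root t : nodes t = root t :: fnodes (kids t).
Proof. by case: t. Qed.
Lemma fnodes_cons t F : fnodes (t :: F) = nodes t ++ fnodes F.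
Proof. by []. Qed.
Lemma fnodes1 t : fnodes [:: t] = nodes t. Proof. exact: cats0. Qed.
Lemma fkids_cons a ts F : fkids (Node a ts :: F) = ts ++ fkids F.
Proof. by []. Qed.
Lemma fnodes_cat F G : fnodes (F ++ G) = fnodes F ++ fnodes G.
Proof. by rewrite /fnodes map_cat flatten_cat. Qed.

Fixpoint subtrees t : seq (otree A) :=
  let: Node _ ts := t in t :: flatten (map subtrees ts).

Definition fsubtrees F := flatten (map subtrees F).

Lemma subtreesE a ts : subtrees (Node a ts) = Node a ts :: fsubtrees ts.
Proof. by []. Qed.
Lemma fsubtrees_cons a ts F :
  fsubtrees (Node a ts :: F) = Node a ts :: fsubtrees ts ++ fsubtrees F.
Proof. by []. Qed.

(** [cut] keeps the depths up to [c], [below] the depths from [c] on. Both keep level [c], just as a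
    level of s-nodes belongs to two slabs. *)
Fixpoint below c F := if c is c'.+1 then below c' (fkids F) else F.

Fixpoint cut c t :=
  Node (root t) (if c is c'.+1 then map (cut c') (kids t) else [::]).

Lemma below_cat c F G : below c (F ++ G) = below c F ++ below c G.
Proof.
by elim: c F G => //= c IH F G; rewrite /fkids map_cat flatten_cat IH.
Qed.

Lemma below0 c : below c [::] = [::]. Proof. by elim: c. Qed.

Lemma belowD c d F : below (c + d) F = below d (below c F).
Proof. by elim: c F => //= c IH F; rewrite IH. Qed.

Lemma below_cons c a ts us :
  below c (Node a ts :: us) =
  (if c is c'.+1 then below c' ts else [:: Node a ts]) ++ below c us.
Proof. by case: c => //= c; rewrite /fkids /= below_cat. Qed.

Lemma size_fnodes_fkids F : size (fnodes F) = size F + size (fnodes (fkids F)).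
Proof.
elim: F => // [[a ts]] F IH; rewrite fnodes_cons nodesE /fkids /= fnodes_cat.
by rewrite !size_cat IH /fkids; lia.
Qed.

Lemma sum_below N F : \sum_(d < N) size (below d F) <= size (fnodes F).
Proof.
elim: N F => [|N IH] F; first by rewrite big_ord0.
by rewrite big_ord_recl /= size_fnodes_fkids leq_add2l; exact: IH.
Qed.

Lemma below_large c F : size (fnodes F) <= c -> below c F = [::].
Proof.
elim: c F => [|c IH] F /=.
  by case: F => // [[a ts] F].
move=> h; apply: IH; case: F h => // t F.
by rewrite [in size _]size_fnodes_fkids /= => h; lia.
Qed.

Lemma size_cut c F :
  size (fnodes (map (cut c) F)) + size (fnodes (below c F)) =
  size (fnodes F) + size (below c F).
Proof.
elim/forest_ind: F c => [|a ts us IHts IHus] c; first by rewrite /= below0.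
rewrite below_cons map_cons !fnodes_cons !fnodes_cat !size_cat.
have := IHus c; rewrite !nodesE; case: c => [|c].
  by rewrite fnodes1 nodesE /=; lia.
by have := IHts c; rewrite /= -/(fnodes _); lia.
Qed.

Lemma height_cut c t : height (cut c t) <= c.
Proof.
elim: c t => [|c IH] [a ts] //=; elim: ts => //= t ts IHts.
by rewrite geq_max ltnS IH.
Qed.

(** [pruned d k P F]: [P] is obtained from [F] by cutting off [d] whole trees
    and [k] proper subtrees. *)
Inductive pruned : nat -> nat -> seq (otree A) -> seq (otree A) -> Prop :=
| pruned_nil : pruned 0 0 [::] [::]
| pruned_drop t d k ps ts :
    pruned d k ps ts -> pruned d.+1 k ps (t :: ts)
| pruned_keep a d k ps ts d' k' qs us :
    pruned d k ps ts -> pruned d' k' qs us ->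
    pruned d' (d + k + k') (Node a ps :: qs) (Node a ts :: us).

Lemma pruned_drop_all F : pruned (size F) 0 [::] F.
Proof. by elim: F => [|t F IH]; constructor. Qed.

Lemma pruned_cat d k ps ts d' k' qs us : pruned d k ps ts ->
  pruned d' k' qs us -> pruned (d + d') (k + k') (ps ++ qs) (ts ++ us).
Proof.
move=> H H'; elim: H => //= [t {}d {}k {}ps {}ts _ IH|a e j rs vs {}d {}k {}ps {}ts h1 _ _ IH].
  by rewrite addSn; constructor.
by rewrite -addnA; constructor.
Qed.

Lemma pruned_refl F : pruned 0 0 F F.
Proof.
elim/forest_ind: F => [|a ts us IHts IHus]; first by constructor.
exact: (pruned_keep a IHts IHus).
Qed.

(** Truncation at a depth drops no root; this makes the results on [pruned] available for slabs as
    well as for pieces of a cover. *)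
Lemma pruned_cut c F : exists k, pruned 0 k (map (cut c) F) F.
Proof.
elim/forest_ind: F c => [|a ts us IHts IHus] c; first by exists 0; constructor.
have [k Hk] := IHus c; case: c Hk => [|c] Hk.
  by exists (size ts + 0 + k); exact: (pruned_keep a (pruned_drop_all ts) Hk).
by have [j Hj] := IHts c; exists (0 + j + k); exact: (pruned_keep a Hj Hk).
Qed.

Lemma pruned_height d k ps ts : pruned d k ps ts -> fheight ps <= fheight ts.
Proof.
elim=> {d k ps ts} [|t d k ps ts _ IH|a d k ps ts d' k' qs us _ IH1 _ IH2] //.
  exact: leq_trans IH (leq_maxr _ _).
by rewrite /fheight /= -/(fheight ps) -/(fheight ts) geq_max !leq_max ltnS IH1 IH2 orbT.
Qed.
End Forests.

(** * Edges and induced subforests *)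

Section EqForests.
Variable A : eqType.
Implicit Types (t u : otree A) (F G : seq (otree A)) (x y : A).

Definition fchildren F x := flatten (map (fun t => children t x) F).

Lemma childrenE a ts x :
  children (Node a ts) x = if a == x then map (@root A) ts else fchildren ts x.
Proof. by []. Qed.

Lemma fchildren_cat F G x : fchildren (F ++ G) x = fchildren F x ++ fchildren G x.
Proof. by rewrite /fchildren map_cat flatten_cat. Qed.

Lemma fchildren_cons t F x : fchildren (t :: F) x = children t x ++ fchildren F x.
Proof. by []. Qed.

Lemma roots_sub F : {subset map (@root A) F <= fnodes F}.
Proof.
elim: F => //= [[a ts]] F IH x; rewrite fnodes_cons mem_cat nodesE !inE.
by case/orP => [->//|/IH ->]; rewrite orbT.
Qed.

Lemma fchildren_notin F x : x \notin fnodes F -> fchildren F x = [::].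
Proof.
elim/forest_ind: F => // a ts us IHts IHus.
rewrite fnodes_cons nodesE /= inE mem_cat !negb_or eq_sym fchildren_cons childrenE.
by case/andP=> /negbTE -> /andP [/IHts -> /IHus ->].
Qed.

Lemma fchildren_sub F x : {subset fchildren F x <= fnodes F}.
Proof.
elim/forest_ind: F => // a ts us IHts IHus y.
rewrite fnodes_cons fchildren_cons childrenE nodesE !mem_cat inE.
case/orP => [|/IHus ->]; last by rewrite orbT.
by case: ifP => _ => [/roots_sub|/IHts] ->; rewrite orbT.
Qed.

Lemma fchildren_parent F x y : y \in fchildren F x -> x \in fnodes F.
Proof. by apply: contraTT => /fchildren_notin ->. Qed.

Lemma uniq_fnodes_cat F G : uniq (fnodes (F ++ G)) ->
  [/\ uniq (fnodes F), uniq (fnodes G) &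
      forall x, x \in fnodes F -> x \notin fnodes G].
Proof.
rewrite fnodes_cat cat_uniq => /and3P [? /hasPn h ?]; split=> // x xF.
by apply/negP => /h; rewrite xF.
Qed.

Lemma uniq_fnodes_cons a ts us : uniq (fnodes (Node a ts :: us)) ->
  [/\ uniq (fnodes ts), uniq (fnodes us), a \notin fnodes ts,
      a \notin fnodes us & forall x, x \in fnodes ts -> x \notin fnodes us].
Proof.
rewrite fnodes_cons /= mem_cat negb_or cat_uniq.
case/andP => /andP [-> ->] /and3P [-> /hasPn h ->]; split=> // x xF.
by apply/negP => /h; rewrite xF.
Qed.

Definition finduced P F :=
  subseq (fnodes P) (fnodes F) /\
  {in fnodes P &, forall x y, (y \in fchildren P x) = (y \in fchildren F x)}.

Lemma finduced_trans G P F : finduced P G -> finduced G F -> finduced P F.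
Proof.
move=> [s1 e1] [s2 e2]; split; first exact: subseq_trans s1 s2.
by move=> x y xP yP; rewrite e1 // e2 //; exact: (mem_subseq s1).
Qed.

Lemma fchildren1 t x : fchildren [:: t] x = children t x. Proof. exact: cats0. Qed.

Lemma finduced1 t u : finduced [:: t] [:: u] <-> induced_subtree t u.
Proof.
rewrite /finduced !fnodes1; split=> -[s e]; split=> // x y xt yt.
  by have := e x y xt yt; rewrite !fchildren1.
by have := e x y xt yt; rewrite !fchildren1.
Qed.

(** The clause on roots feeds the induction for edges: the children of a kept node are the roots of
    the forest below it. *)
Lemma pruned_rel d k P F : pruned d k P F -> uniq (fnodes F) ->
  [/\ subseq (fnodes P) (fnodes F),
      {in fnodes P, forall y,
        (y \in map (@root A) P) = (y \in map (@root A) F)} &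
      {in fnodes P &, forall x y, (y \in fchildren P x) = (y \in fchildren F x)}].
Proof.
elim=> {d k P F} [|t d k ps ts _ IH|a d k ps ts d' k' qs us _ IH1 _ IH2] //.
  rewrite -cat1s => /uniq_fnodes_cat [_ /IH [s r e] dj].
  have nt x : x \in fnodes ps -> x \notin fnodes [:: t].
    by move=> xp; apply/negP => /dj; rewrite (mem_subseq s xp).
  split.
  - by rewrite fnodes_cat; apply: subseq_trans s (suffix_subseq _ _).
  - move=> y yp; rewrite r // map_cat mem_cat.
    by rewrite (negbTE (contra (@roots_sub [:: t] y) _)) ?nt.
  - by move=> x y xp yp; rewrite e // fchildren_cat (fchildren_notin (nt x xp)).
case/uniq_fnodes_cons => /IH1 [s1 r1 e1] /IH2 [s2 r2 e2] ats aus dj.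
have sub1 := mem_subseq s1; have sub2 := mem_subseq s2.
have nsub G x : x \notin fnodes G -> (x \in map (@root A) G) = false.
  by move=> h; apply/negbTE; apply: contra h; apply: roots_sub.
have nchild G x y : y \notin fnodes G -> (y \in fchildren G x) = false.
  by move=> h; apply/negbTE; apply: contra h; apply: fchildren_sub.
split.
- by rewrite !fnodes_cons /= eqxx cat_subseq.
- move=> y; rewrite fnodes_cons nodesE /= !inE mem_cat.
  case: eqVneq => //= nya /orP [yp|/r2 //].
  by rewrite !nsub //; [|apply/negP => /sub2]; rewrite ?(negbTE (dj y (sub1 y yp))) //; apply: dj; apply: sub1.
move=> x y; rewrite !fchildren_cons !childrenE !fnodes_cons !nodesE.
rewrite !(inE, mem_cat) => hx hy.
have aps : a \notin fnodes ps by apply: contra ats; apply: sub1.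
have aqs : a \notin fnodes qs by apply: contra aus; apply: sub2.
have nodis y' : y' \in a :: fnodes qs -> y' \notin fnodes ts.
  by rewrite inE => /orP [/eqP ->|/sub2 h] //; apply/negP => /dj; rewrite h.
have nodis' y' : y' \in a :: fnodes ps -> y' \notin fnodes us.
  by rewrite inE => /orP [/eqP ->|/sub1 /dj].
have nps y' : y' \notin fnodes ts -> y' \notin fnodes ps by apply/contra/sub1.
have nqs y' : y' \notin fnodes us -> y' \notin fnodes qs by apply/contra/sub2.
case: (eqVneq a x) hx => [<- _|nax] /=.
  rewrite !(@fchildren_notin _ a) // !orbF.
  have [yps|yps] := boolP (y \in fnodes ps); first exact: r1.
  have yts : y \notin fnodes ts by apply: nodis; rewrite inE; move: hy; rewrite (negbTE yps) orbF.
  by rewrite !nsub.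
move=> /= /orP [xps|xqs].
  have xus : x \notin fnodes us by apply: nodis'; rewrite inE xps orbT.
  rewrite !(@fchildren_notin _ x xus) !(@fchildren_notin _ x (nqs _ xus)) !orbF.
  have [yps|yps] := boolP (y \in fnodes ps); first exact: e1.
  have yts : y \notin fnodes ts by apply: nodis; rewrite inE; move: hy; rewrite (negbTE yps) orbF.
  by rewrite !nchild // nps.
have xts : x \notin fnodes ts by apply: nodis; rewrite inE xqs orbT.
rewrite !(@fchildren_notin _ x xts) !(@fchildren_notin _ x (nps _ xts)) /=.
have [yqs|yqs] := boolP (y \in fnodes qs); first exact: e2.
have yus : y \notin fnodes us by apply: nodis'; rewrite inE; move: hy; rewrite (negbTE yqs) orbF.
by rewrite !nchild // nqs.
Qed.

Lemma pruned_induced d k P F :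
  pruned d k P F -> uniq (fnodes F) -> finduced P F.
Proof. by move=> h /(pruned_rel h) []. Qed.

Lemma pruned_mem d k P F : pruned d k P F -> {subset fnodes P <= fnodes F}.
Proof.
elim=> {d k P F} [|t d k ps ts _ IH|a d k ps ts d' k' qs us _ IH1 _ IH2] // x.
  by move/IH; rewrite fnodes_cons mem_cat => ->; rewrite orbT.
rewrite !fnodes_cons !nodesE !mem_cat !inE -!orbA.
by case/or3P => [->|/IH1 ->|/IH2 ->]; rewrite ?orbT.
Qed.

(** Both counts are needed at once, since the trees dropped directly below a kept node are the exits
    of that node; [E] collects them. *)
Lemma pruned_exits d k P F : pruned d k P F -> uniq (fnodes F) ->
  count [pred y | y \notin fnodes P] (map (@root A) F) <= d /\
  exists2 E : seq (A * A), size E <= k &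
    forall x y, x \in fnodes P -> y \in fchildren F x -> y \notin fnodes P ->
      (x, y) \in E.
Proof.
elim=> {d k P F} [|t d k ps ts h IH|a d k ps ts d' k' qs us h1 IH1 h2 IH2].
- by move=> _; split=> //; exists [::].
- rewrite -cat1s => /uniq_fnodes_cat [_ /IH [c [E sE EP]] dj]; split.
    by rewrite /= -[d.+1]add1n leq_add // leq_b1.
  exists E => // x y xp; rewrite fchildren_cat.
  rewrite (@fchildren_notin [:: t]) => [yt yp|]; first exact: EP.
  by apply/negP => /dj; rewrite (pruned_mem h xp).
case/uniq_fnodes_cons => u1 u2 ats aus dj.
have sub1 := pruned_mem h1; have sub2 := pruned_mem h2.
have [c1 [E1 s1 E1P]] := IH1 u1; have [c2 [E2 s2 E2P]] := IH2 u2.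
have dropin y P Q : y \notin P ++ Q -> (y \notin P) && (y \notin Q).
  by rewrite mem_cat negb_or.
split.
  rewrite /= fnodes_cons inE nodesE eqxx /= add0n; apply: leq_trans c2.
  apply: sub_count => y /=.
  by rewrite inE mem_cat !negb_or => /and3P [].
exists ([seq (a, y) | y <- map (@root A) ts & y \notin fnodes ps] ++ E1 ++ E2).
  rewrite !size_cat size_map size_filter -addnA.
  by apply: leq_add; [exact: c1|exact: leq_add].
move=> x y; rewrite fchildren_cons childrenE fnodes_cons nodesE !(inE, mem_cat).
rewrite !negb_or -andbA => hx hy /and3P [nya yps yqs].
case: (eqVneq a x) hx hy => [<- _|nax].
  rewrite (@fchildren_notin us a) // orbF => yr.
  by rewrite (map_f (pair a)) // mem_filter yps.
move=> /= /orP [xps|xqs].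
  rewrite (@fchildren_notin us x) ?orbF => [yt|]; last by apply: dj; apply: sub1.
  by rewrite E1P // orbT.
rewrite (@fchildren_notin ts x) /= => [yt|]; first by rewrite E2P ?orbT.
by apply/negP => /dj; rewrite sub2.
Qed.

Lemma fkids_induced F : uniq (fnodes F) -> finduced (fkids F) F.
Proof.
move=> uF; split.
  elim: F {uF} => // [[a ts]] F IH; rewrite fnodes_cons fkids_cons fnodes_cat.
  by rewrite cat_subseq // nodesE subseq_cons.
suff e F' x : uniq (fnodes F') -> x \in fnodes (fkids F') ->
  fchildren (fkids F') x = fchildren F' x by move=> x y xk _; rewrite e.
elim: F' => // [[a ts]] F' IH /uniq_fnodes_cons [u1 u2 ats aus dj].
rewrite fkids_cons fnodes_cat mem_cat fchildren_cat fchildren_cons childrenE.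
have subk : {subset fnodes (fkids F') <= fnodes F'}.
  elim: F' {IH u2 aus dj} => // [[b vs]] G IH y.
  rewrite fkids_cons fnodes_cons nodesE fnodes_cat /= inE !mem_cat.
  by case/orP => [->|/IH ->]; rewrite ?orbT.
case/orP => [xts|xk].
  rewrite (@fchildren_notin F') ?dj // (@fchildren_notin (fkids F')).
    by case: eqVneq => // eax; rewrite eax xts in ats.
  by apply/negP => /subk; apply/negP/dj.
rewrite IH //; congr (_ ++ _); rewrite ifN; last first.
  by apply: contra aus => /eqP ->; apply: subk.
by rewrite [LHS]fchildren_notin ?[RHS]fchildren_notin //; apply/negP => /dj; rewrite subk.
Qed.

Lemma below_induced c F : uniq (fnodes F) -> finduced (below c F) F.
Proof.
elim: c F => [|c IH] F uF /=; first by split.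
have kF := fkids_induced uF; apply: finduced_trans (kF); apply: IH.
by apply: subseq_uniq uF; case: kF.
Qed.

Lemma cut_induced c F : uniq (fnodes F) -> finduced (map (cut c) F) F.
Proof. by have [k h] := pruned_cut c F; exact: pruned_induced h. Qed.

Lemma mem_induced t F : uniq (fnodes F) -> t \in F -> finduced [:: t] F.
Proof.
move=> + tF; case/splitPr: tF => l r uF.
apply: (pruned_induced _ uF).
exact: pruned_cat (pruned_drop_all l) (pruned_cat (pruned_refl [:: t]) (pruned_drop_all r)).
Qed.

Lemma finduced_uniq P F : finduced P F -> uniq (fnodes F) -> uniq (fnodes P).
Proof. by case=> /subseq_uniq. Qed.

Lemma subtrees_induced t S : uniq (nodes S) -> t \in subtrees S ->
  finduced [:: t] [:: S].
Proof.
suff h F : uniq (fnodes F) -> t \in fsubtrees F -> finduced [:: t] F.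
  by move=> uS tS; apply: h; rewrite ?fnodes1 // /fsubtrees /= cats0.
elim/forest_ind: F => // a ts us IHts IHus uF.
rewrite fsubtrees_cons inE mem_cat.
have u1 := uF; rewrite -cat1s in u1; have [uN uus _] := uniq_fnodes_cat u1.
case/or3P => [/eqP ->|tts|tus].
- by apply: mem_induced; rewrite ?mem_head.
- have [uts _ _ _ _] := uniq_fnodes_cons uF.
  apply: finduced_trans (IHts uts tts) _.
  apply: finduced_trans (@mem_induced (Node a ts) _ uF (mem_head _ _)).
  by have := fkids_induced uN; rewrite fkids_cons cats0.
- apply: finduced_trans (IHus uus tus) _; apply: (pruned_induced _ uF).
  exact: pruned_drop (pruned_refl us).
Qed.

Lemma fchildren_nonroot F x y : uniq (fnodes F) -> y \in fchildren F x ->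
  y \notin map (@root A) F.
Proof.
elim/forest_ind: F => // a ts us IHts IHus.
case/uniq_fnodes_cons => u1 u2 ats aus dj.
rewrite fchildren_cons mem_cat inE negb_or => /orP [|yus].
  rewrite childrenE => yc; have yts : y \in fnodes ts.
    by move: yc; case: ifP => _ => [/roots_sub|/fchildren_sub].
  apply/andP; split; first by apply: contraNneq ats => /= <-.
  by apply: contra (dj y yts); exact: roots_sub.
rewrite IHus // andbT; apply: contraNneq aus => /= <-; exact: fchildren_sub yus.
Qed.

Lemma fchildren_inj F x x' y : uniq (fnodes F) -> y \in fchildren F x ->
  y \in fchildren F x' -> x = x'.
Proof.
elim/forest_ind: F => // a ts us IHts IHus.
case/uniq_fnodes_cons => u1 u2 ats aus dj.
have tsin z : y \in (if a == z then map (@root A) ts else fchildren ts z) -> y \in fnodes ts.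
  by case: ifP => _ => [/roots_sub|/fchildren_sub].
rewrite !fchildren_cons !childrenE !mem_cat.
case/orP => [yt|yu] /orP [yt'|yu'].
- move: yt yt'; case: eqP => [<-|_] yt; case: eqP => [<-|_] yt' //.
  + by move: yt; rewrite (negbTE (fchildren_nonroot u1 yt')).
  + by move: yt'; rewrite (negbTE (fchildren_nonroot u1 yt)).
  + exact: IHts.
- by move: (dj _ (tsin _ yt)); rewrite (fchildren_sub yu').
- by move: (dj _ (tsin _ yt')); rewrite (fchildren_sub yu).
- exact: IHus.
Qed.

Lemma nonroot_parent F y : uniq (fnodes F) -> y \in fnodes F ->
  y \notin map (@root A) F -> exists x, y \in fchildren F x.
Proof.
elim/forest_ind: F => // a ts us IHts IHus.
case/uniq_fnodes_cons => u1 u2 ats aus dj.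
rewrite fnodes_cons nodesE /= !inE mem_cat negb_or.
case/or3P=> [->|yts|yus] // /andP [nya nyr]; last first.
  by have [x yx] := IHus u2 yus nyr; exists x; rewrite fchildren_cons mem_cat yx orbT.
have [yr|yr] := boolP (y \in map (@root A) ts).
  by exists a; rewrite fchildren_cons childrenE eqxx mem_cat yr.
have [x yx] := IHts u1 yts yr; exists x; rewrite fchildren_cons childrenE mem_cat.
by rewrite ifN ?yx //; apply: contraNneq ats => ->; exact: fchildren_parent yx.
Qed.
End EqForests.

(** * Covering a tree *)

Lemma count_le1_uniq (T : eqType) (s : seq T) :
  (forall x, count_mem x s <= 1) -> uniq s.
Proof.
move=> h; apply: count_mem_uniq => x; have := h x.
by rewrite -has_pred1 has_count; case: (count_mem x s) => [|[]].
Qed.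

Section Covering.
Variables (A : eqType) (B : nat).
Hypothesis B_ge3 : 3 <= B.
Implicit Types (t p : otree A) (ts us ps : seq (otree A)) (v a x y : A).

(** What is known at a node after scanning a suffix of its children. [room] is [B] minus the size of
    the group including the node itself, [exits] records that the current group has used up its one
    outgoing edge, and [closed] that a piece with this root has been detached. *)
Record state := State
  { done : seq (otree A); group : seq (otree A); room : nat;
    exits : bool; closed : bool }.

Definition init := State [::] [::] B.-1 false false.

Definition leftover v s :=
  if nilp (group s) then [::] else [:: Node v (group s)].

(** The order of [acc] is the one in which the program conses pieces onto its accumulator, so that
    its output equals the cover and is not merely a permutation of it. *)
Definition scan_kid v a q s :=
  let overflow := exits s && (closed q || exits q) in
  let acc := (if overflow then leftover v s else [::]) ++
    (if closed q then Node a (group q) :: done q else done q) ++ done s in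
  let s1 := if overflow then State acc [::] B.-1 false true
            else State acc (group s) (room s) (exits s) (closed s) in
  if closed q then State (done s1) (group s1) (room s1) true (closed s1)
  else
    let kid := Node a (group q) in
    (* [B - room q] is the number of nodes of [kid], because [room q] already deducts the root. *)
    let r := room s1 - (B - room q) in
    if r == 0 then State (Node v (kid :: group s1) :: done s1) [::] B.-1 false true
    else State (done s1) (kid :: group s1) r (exits s1 || exits q) (closed s1).

Fixpoint scan t :=
  let: Node v ts := t in foldr (fun u s => scan_kid v (root u) (scan u) s) init ts.

Definition cover t := Node (root t) (group (scan t)) :: done (scan t).

(** Dropped children and cut subtrees share one budget: a child dropped at a node becomes a cut
    proper subtree once the group of that node is merged into its parent. [k <= 1] yields the single
    outgoing edge, [d <= 1] the two blocks. *)
Definition section t p := exists l m r d k,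
  [/\ kids t = l ++ m ++ r, root p = root t, pruned d k (kids p) m & d + k <= 1].

(** Pieces with children differ because they have no common non-root nodes; only pieces consisting
    of a root alone could coincide, so they are tracked separately. *)
Definition singles ps := map (@root A) [seq p <- ps | nilp (kids p)].

(** [cr] lists the closed nodes; all other nodes of [w] are in [g] or are non-root
    nodes of exactly one piece. Only the last piece of a closed node may consist
    of its root alone, so that the pieces are distinct. *)
Definition ledger ps w g cr := [/\ perm_eq w (g ++ cr ++ fnodes (fkids ps)),
  {subset cr <= map (@root A) ps} &
  forall x, count_mem x (singles ps) <= count_mem x cr].

Definition valid_piece S p :=
  num_nodes p <= 2 * B /\ exists2 t, t \in subtrees S & section t p.

(** [e] pieces are yet to be paid for. *)
Record inv e v us s : Prop := Inv {
  inv_done : {in done s, forall p, valid_piece (Node v us) p};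
  inv_group : exists m r d k, [/\ us = m ++ r, pruned d k (group s) m,
    d + k = exits s & ~~ closed s -> r = [::]];
  inv_room : 0 < room s /\ room s + 1 + size (fnodes (group s)) = B;
  inv_perm : exists2 cr, ledger (done s) (fnodes us) (fnodes (group s)) cr &
    {subset map (@root A) (done s) <= if closed s then v :: cr else cr};
  inv_count : size (done s) * B + (if closed s then 3 else 2 * exits s) * B
    + 6 * size (fnodes (group s)) <= 6 * size (fnodes us) + e * B }.

Lemma inv_init v : inv 0 v [::] init.
Proof.
split=> //.
- by exists [::], [::], 0, 0; split=> //; constructor.
- by split=> /=; lia.
- by exists [::].
Qed.

Lemma fkids_cat ps ps' : fkids (ps ++ ps') = fkids ps ++ fkids ps' :> seq (otree A).
Proof. by rewrite /fkids map_cat flatten_cat. Qed.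

Lemma singles_cat ps ps' : singles (ps ++ ps') = singles ps ++ singles ps'.
Proof. by rewrite /singles filter_cat map_cat. Qed.

Lemma perm_fnodes ps ps' : perm_eq ps ps' -> perm_eq (fnodes ps) (fnodes ps').
Proof. by move=> h; apply: perm_flatten; apply: perm_map. Qed.

Lemma perm_fkids ps ps' : perm_eq ps ps' -> perm_eq (fkids ps) (fkids ps').
Proof. by move=> h; apply: perm_flatten; apply: perm_map. Qed.

Lemma ledger_perm ps ps' w g cr : perm_eq ps ps' -> ledger ps w g cr -> ledger ps' w g cr.
Proof.
move=> h [pm sub sg]; split.
- by apply: perm_trans pm _; rewrite !perm_cat2l; apply/perm_fnodes/perm_fkids.
- by move=> x /sub; rewrite (perm_mem (perm_map _ h)).
- move=> x; apply: leq_trans (sg x); rewrite leq_eqVlt; apply/orP; left.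
  by apply/eqP; apply: permP; apply: perm_map; apply: perm_filter; rewrite perm_sym.
Qed.

Lemma inv_perm_done n v us ps ps' g r e c : perm_eq ps ps' ->
  inv n v us (State ps g r e c) -> inv n v us (State ps' g r e c).
Proof.
move=> h [/= id ig ir [cr il sub] ic]; split=> //=.
- by move=> p; rewrite -(perm_mem h); exact: id.
- exists cr; first exact: ledger_perm il.
  by move=> x; rewrite -(perm_mem (perm_map _ h)); exact: sub.
- by rewrite -(perm_size h).
Qed.

(** Detaching costs at most [B] for the piece and [3 * B] for closing [v]. If [v] was open, the
    outgoing edge releases [2 * B]; if it was closed, its [3 * B] are already there. The debt is
    thus at most 2 pieces. *)
Lemma inv_break v us s : inv 0 v us s -> exits s ->
  inv 2 v us (State (leftover v s ++ done s) [::] B.-1 false true).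
Proof.
case: s => ps g r e c [/= id [m [rest [d [k [eus pr edk ec]]]]] [r0 rB] [cr [pm sub sg] rt] ic] he.
rewrite /leftover /=; split=> /=.
- move=> p; rewrite mem_cat => /orP [|/id //].
  case: nilP => // _; rewrite inE => /eqP ->; split.
    by rewrite /num_nodes nodesE /=; lia.
  exists (Node v us); rewrite ?subtreesE ?mem_head //.
  by exists [::], m, rest, d, k; split=> //; rewrite edk leq_b1.
- by exists [::], us, 0, 0; split=> //; constructor.
- by split; lia.
- exists cr; last first.
    move=> x; rewrite map_cat mem_cat inE => /orP [|/rt].
      by case: nilP => //= _; rewrite inE => /eqP ->; rewrite eqxx.
    by case: (c); rewrite ?inE // => ->; rewrite orbT.
  split.
  + case: nilP => [g0|_]; first by move: pm; rewrite g0.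
    move/permP: pm => pm; apply/permP => Q; have := pm Q.
    by rewrite /= fkids_cons fnodes_cat !count_cat; lia.
  + by move=> x /sub; rewrite map_cat mem_cat => ->; rewrite orbT.
  + move=> x; rewrite singles_cat count_cat; have := sg x.
    by case: (g).
- rewrite he in ic; rewrite size_cat; move: ic; case: (g) => [|t g'] /=; case: (c); rewrite /=; nia.
Qed.

Lemma section_cons v us u p : section (Node v us) p -> section (Node v (u :: us)) p.
Proof.
by move=> [l [m [r [d [k [/= -> e1 e2 e3]]]]]]; exists (u :: l), m, r, d, k.
Qed.

Lemma valid_tail v us u p : valid_piece (Node v us) p -> valid_piece (Node v (u :: us)) p.
Proof.
case=> sz [t]; rewrite subtreesE inE => /orP [/eqP -> /(section_cons u) sec|tin sec].
  by split=> //; exists (Node v (u :: us)); rewrite ?subtreesE ?mem_head.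
split=> //; exists t => //; case: u => a ts.
by rewrite subtreesE fsubtrees_cons !inE mem_cat tin !orbT.
Qed.

Lemma valid_head v us u p : valid_piece u p -> valid_piece (Node v (u :: us)) p.
Proof.
case=> sz [t tin sec]; split=> //; exists t => //; case: u tin => a ts.
rewrite !subtreesE fsubtrees_cons !inE mem_cat.
by case/orP=> ->; rewrite ?orbT.
Qed.

Lemma valid_cat e v us a ts q s : inv e v us s -> inv 0 a ts q ->
  {in done q ++ done s, forall p, valid_piece (Node v (Node a ts :: us)) p}.
Proof.
move=> is_ iq p; rewrite mem_cat => /orP [/(inv_done iq) h|/(inv_done is_) h].
  exact: valid_head.
exact: valid_tail.
Qed.

(** The [3 * B] of the closed child pay for its last piece and leave [2 * B]: for the new outgoing
    edge if [v] is open, for the debt [e] if [v] is closed. *)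
Lemma inv_closed e v us s a ts q : inv e v us s -> inv 0 a ts q ->
  e <= 2 * closed s -> exits s = false -> closed q -> inv 0 v (Node a ts :: us)
    (State (Node a (group q) :: done q ++ done s) (group s) (room s) true (closed s)).
Proof.
move=> is_ iq he es cq; have vd := valid_cat is_ iq.
case: is_ => _ [m [r [d [k [eus pr edk ec]]]]] rm [cr [pm sub sg] rt] ic.
case: iq => _ [m' [r' [d' [k' [ets pr' edk' _]]]]] rm' [cr' [pm' sub' sg'] rt'] ic'.
rewrite cq in rt' ic'; rewrite es in edk ic.
split=> /=.
- move=> p; rewrite inE => /orP [/eqP ->|/vd //]; apply: valid_head; split.
    by rewrite /num_nodes nodesE /=; lia.
  exists (Node a ts); first by rewrite subtreesE mem_head.
  by exists [::], m', r', d', k'; rewrite /= edk' leq_b1.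
- exists (Node a ts :: m), r, d.+1, k; split; rewrite ?eus //; first by constructor.
  by rewrite addSn edk.
- by [].
- exists (a :: cr' ++ cr); last first.
    move=> x; rewrite inE map_cat mem_cat => /or3P [/eqP ->|/rt' h|/rt h].
    + by case: ifP => _; rewrite ?inE eqxx ?orbT.
    + case: ifP => _; rewrite ?inE ?mem_cat; move: h; rewrite inE => /orP [|] ->; rewrite ?orbT //.
    + by case: ifP h => _; rewrite !inE ?mem_cat => h; [case/orP: h => ->|rewrite h]; rewrite ?orbT.
  split.
  + move/permP: pm => pm; move/permP: pm' => pm'; apply/permP => Q.
    have := pm Q; have := pm' Q.
    rewrite fkids_cons fkids_cat !fnodes_cons !fnodes_cat nodesE.
    by rewrite !count_cat /= !count_cat; lia.
  + move=> x; rewrite map_cons map_cat !inE !mem_cat.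
    by case/or3P => [->//|/sub' ->|/sub ->]; rewrite ?orbT.
  + move=> x; have := sg x; have := sg' x; rewrite /= count_cat.
    have -> : singles (Node a (group q) :: done q ++ done s) =
      singles [:: Node a (group q)] ++ singles (done q) ++ singles (done s).
      by rewrite -singles_cat -singles_cat.
    rewrite !count_cat /singles /=; case: (nilp _) => /=; rewrite ?addn0; lia.
- rewrite !size_cat -/(fnodes ts) -/(fnodes us).
  by case: (closed s) he ic => /= he; have := leq_mul2r B e; nia.
Qed.

(** When the room runs out, the group and the child have at least [B - 1] nodes together. Their
    potential is at least [6 * (B - 1)], which is at least [4 * B] by [3 <= B]: one piece plus the
    closing of [v]. A debt [e] is settled by the [2 * B] of the child's outgoing edge. *)
Lemma inv_open e v us s a ts q : inv e v us s -> inv 0 a ts q ->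
  e <= 2 * (closed s && exits q) ->
  exits s && exits q = false -> closed q = false ->
  let kid := Node a (group q) in let r := room s - (B - room q) in
  inv 0 v (Node a ts :: us)
    (if r == 0 then
       State (Node v (kid :: group s) :: done q ++ done s) [::] B.-1 false true
     else State (done q ++ done s) (kid :: group s) r (exits s || exits q) (closed s)).
Proof.
move=> is_ iq he es cq /=; have vd := valid_cat is_ iq.
case: is_ => _ [m [r [d [k [eus pr edk ec]]]]] rm [cr [pm sub sg] rt] ic.
case: iq => _ [m' [r' [d' [k' [ets pr' edk' ec']]]]] rm' [cr' [pm' sub' sg'] rt'] ic'.
(* An open child has detached nothing, so its group is pruned from all of its children and merging
   it hides no further gap. *)
rewrite cq /= in rt' ic' ec'; have {}ets : ts = m' by rewrite ets (ec' isT) cats0.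
subst m'.
have prk : pruned d (d' + k' + k) (Node a (group q) :: group s) (Node a ts :: m).
  by constructor.
have dk : d + (d' + k' + k) = exits s || exits q.
  by rewrite edk' addnCA edk; case: (exits s) (exits q) es => [] [].
have [r1 r2] := rm; have [r1' r2'] := rm'.
have pm'' : perm_eq (fnodes (Node a ts :: us))
  (fnodes (Node a (group q) :: group s) ++ (cr' ++ cr) ++ fnodes (fkids (done q ++ done s))).
  move/permP: pm => pm; move/permP: pm' => pm'; apply/permP => Q.
  have := pm Q; have := pm' Q.
  rewrite fkids_cat !fnodes_cons !fnodes_cat !nodesE.
  by rewrite !count_cat /= ?count_cat; lia.
have sub'' : {subset cr' ++ cr <= map (@root A) (done q ++ done s)}.
  by move=> x; rewrite map_cat !mem_cat => /orP [/sub' ->|/sub ->]; rewrite ?orbT.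
have sg'' x : count_mem x (singles (done q ++ done s)) <= count_mem x (cr' ++ cr).
  by rewrite singles_cat !count_cat leq_add.
case: eqP => r0; split=> /=.
- move=> p; rewrite inE => /orP [/eqP ->|/vd //]; split.
    by rewrite /num_nodes nodesE fnodes_cons nodesE /= size_cat; lia.
  exists (Node v (Node a ts :: us)); first by rewrite subtreesE mem_head.
  exists [::], (Node a ts :: m), r, d, (d' + k' + k).
  by split=> //=; rewrite ?eus // dk leq_b1.
- by exists [::], (Node a ts :: us), 0, 0; split=> //; constructor.
- by split; lia.
- exists (cr' ++ cr); last first.
    move=> x; rewrite inE map_cat !inE !mem_cat.
    case/or3P => [->//|/rt' ->|/rt]; rewrite ?orbT //.
    by case: ifP => _; [rewrite inE => /orP [] ->|move=> ->]; rewrite ?orbT.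
  split.
  + apply: perm_trans pm'' _; rewrite fkids_cons (fnodes_cat (_ :: _)).
    by rewrite perm_catCA.
  + by move=> x /sub'' h; rewrite inE h orbT.
  + exact: sg''.
- rewrite !size_cat -/(fnodes ts) -/(fnodes us).
  by case: (closed s) he ic; case: (exits s) es; case: (exits q) ic' => //=; nia.
- exact: vd.
- exists (Node a ts :: m), r, d, (d' + k' + k).
  by split; rewrite ?eus.
- by rewrite !size_cat -/(fnodes (group q)) -/(fnodes (group s)); lia.
- exists (cr' ++ cr); first by split.
  move=> x; rewrite map_cat mem_cat => /orP [/rt'|/rt]; case: ifP => _; rewrite ?inE ?mem_cat => h.
  + by rewrite h orbT.
  + by rewrite h.
  + by case/orP: h => ->; rewrite ?orbT.
  + by rewrite h orbT.
- rewrite !size_cat -/(fnodes ts) -/(fnodes us) -/(fnodes (group q)) -/(fnodes (group s)).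
  by case: (closed s) he ic; case: (exits s) es; case: (exits q) ic' => //=; nia.
Qed.

Lemma inv_scan_kid v us s a ts q : inv 0 v us s -> inv 0 a ts q ->
  inv 0 v (Node a ts :: us) (scan_kid v a q s).
Proof.
move=> is_ iq; rewrite /scan_kid.
have [/andP [es oq]|ov] := boolP (exits s && _); rewrite /=.
  have ib := inv_break is_ es.
  have [cq|cq] := boolP (closed q).
    have := inv_closed ib iq (leqnn 2) (erefl _) cq; apply: inv_perm_done.
    by rewrite -cat_cons perm_catCA.
  have eq : 2 <= 2 * (true && exits q) by move: oq; rewrite (negbTE cq) /= => ->.
  have := inv_open ib iq eq (erefl _) (negbTE cq); rewrite /=.
  by case: ifP => _; apply: inv_perm_done; rewrite ?perm_cons perm_catCA.
have [cq|cq] := boolP (closed q).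
  apply: (inv_closed is_ iq _ _ cq) => //.
  by move: ov; rewrite cq andbT; exact: negbTE.
have es : exits s && exits q = false.
  by apply/negbTE; move: ov; rewrite (negbTE cq).
exact: (inv_open is_ iq (leq0n _) es (negbTE cq)).
Qed.

Lemma inv_scan v ts : inv 0 v ts (scan (Node v ts)).
Proof.
suff h t : inv 0 (root t) (kids t) (scan t) by exact: (h (Node v ts)).
elim/otree_ind_seq: t => a us IHus /=.
elim: us IHus => [_|[b vs] us IHvs [h /IHvs hs]]; first exact: inv_init.
exact: inv_scan_kid.
Qed.

Lemma cover_valid S : {in cover S, forall p, valid_piece S p}.
Proof.
case: S => v ts; have := inv_scan v ts; rewrite /cover.
set s := scan (Node v ts); case=> vd gr rm _ _.
move=> p; rewrite inE => /orP [/eqP ->|/vd //]; split.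
  by rewrite /num_nodes nodesE /=; lia.
have [m [r [d [k [ets pr edk _]]]]] := gr.
exists (Node v ts); first by rewrite subtreesE mem_head.
by exists [::], m, r, d, k; rewrite edk leq_b1.
Qed.

(** The last group becomes a piece however small it is; the summand [B] accounts for it. *)
Lemma size_cover S : size (cover S) * B <= 6 * num_nodes S + B.
Proof.
case: S => v ts; have := inv_count (inv_scan v ts); rewrite /cover.
by set s := scan (Node v ts); rewrite /num_nodes nodesE /=; nia.
Qed.

Lemma cover_ledger S : exists2 cr,
  ledger (cover S) (nodes S) [::] cr &
  {subset map (@root A) (cover S) <= cr}.
Proof.
case: S => v ts; have := inv_scan v ts; rewrite /cover.
set s := scan (Node v ts); case=> _ _ _ [cr [pm sub sg] rt] _.
exists (v :: cr); last first.
  move=> x; rewrite !inE => /orP [->//|/rt].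
  by case: ifP => _; rewrite ?inE => h; rewrite ?h ?orbT.
split.
- rewrite nodesE perm_cons; apply: perm_trans pm _.
  by rewrite fkids_cons fnodes_cat perm_catCA.
- move=> x; rewrite inE => /orP [/eqP ->|/sub h]; first exact: mem_head.
  by rewrite inE h orbT.
- move=> x; apply: (@leq_trans ((v == x) + count_mem x (singles (done s)))).
    by rewrite /singles /=; case: nilp; rewrite /= ?leq_addl.
  by rewrite leq_add2l; exact: sg.
Qed.
End Covering.

(** * Disjointness, exits and blocks of the cover *)

Section CoveringEq.
Variables (A : eqType) (B : nat) (S : otree A).
Hypotheses (B_ge3 : 3 <= B) (uS : uniq (nodes S)).
Implicit Types (t p : otree A) (ts us ps : seq (otree A)) (v a x y : A).

Lemma fkids_disjoint ps x p q : uniq (fnodes (fkids ps)) -> p \in ps -> q \in ps ->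
  x \in fnodes (kids p) -> x \in fnodes (kids q) -> p = q.
Proof.
elim: ps => // [[a ts]] ps IH; rewrite fkids_cons => /uniq_fnodes_cat [u1 u2 dj].
have sub r : r \in ps -> x \in fnodes (kids r) -> x \in fnodes (fkids ps).
  elim: ps {IH u2 dj} => // [[b vs]] ps IH; rewrite fkids_cons fnodes_cat mem_cat inE.
  by case/orP=> [/eqP ->|/IH h /h ->]; rewrite ?orbT // => ->.
rewrite !inE => /orP [/eqP ->|pps] /orP [/eqP ->|qps] //= xp xq.
- by have := dj x xp; rewrite (sub q).
- by have := dj x xq; rewrite (sub p).
- exact: IH.
Qed.

Lemma mem_fkids p ps x : p \in ps -> x \in fnodes (kids p) -> x \in fnodes (fkids ps).
Proof.
elim: ps => // [[b vs]] ps IH; rewrite fkids_cons fnodes_cat mem_cat inE.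
by case/orP=> [/eqP ->|/IH h /h ->]; rewrite ?orbT // => ->.
Qed.

(** All roots of pieces are in [cr], and in a duplicate-free tree the ledger separates [cr] from the
    non-root nodes, each of which occurs in one piece only. *)
Lemma cover_disjoint : {in cover B S &, forall p q, p != q ->
  forall x, x \in nodes p -> x \in nodes q -> x = root p /\ x = root q}.
Proof.
have [cr [pm _ _] rt] := cover_ledger B_ge3 S.
move: uS; rewrite (perm_uniq pm) cat0s cat_uniq => /and3P [_ /hasPn dj uk].
have notroot p q x : p \in cover B S -> q \in cover B S ->
    x \in fnodes (kids p) -> x == root q -> False.
  move=> pin qin xp /eqP xq; have /dj/negP := mem_fkids pin xp; apply.
  by apply: rt; rewrite xq map_f.
move=> p q pin qin npq x; rewrite !nodes_root !inE.
case/orP=> [xp|xp] /orP [xq|xq].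
- by move/eqP: xp; move/eqP: xq.
- by case: (notroot q p x).
- by case: (notroot p q x).
- by move: npq; rewrite (fkids_disjoint uk pin qin xp xq) eqxx.
Qed.

(** A piece with children is determined by any of its non-root nodes. A piece without children is
    determined by its root, and the ledger allows one such piece per entry of the duplicate-free
    list [cr]. *)
Lemma cover_uniq : uniq (cover B S).
Proof.
have [cr [pm _ sg] rt] := cover_ledger B_ge3 S.
move: uS; rewrite (perm_uniq pm) cat0s cat_uniq => /and3P [ucr _ uk].
have us : uniq (singles (cover B S)).
  by apply: count_le1_uniq => x; apply: leq_trans (sg x) _; rewrite count_uniq_mem ?leq_b1.
elim: (cover B S) uk us => // [[a ts]] ps IH; rewrite fkids_cons.
case/uniq_fnodes_cat => u1 u2 dj; rewrite /singles /= => us.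
rewrite IH // ?andbT; last by move: us; case: nilp => //= /andP [].
apply/negP => ain; case: ts u1 dj us ain => [|[b vs] ts] u1 dj us ain.
  move: us; rewrite /= => /andP [/negP us _]; apply: us.
  by apply/mapP; exists (Node a [::]); rewrite ?mem_filter.
have := dj b; rewrite fnodes_cons nodesE mem_head (mem_fkids ain) => [/(_ isT)|] //.
by rewrite fnodes_cons nodesE mem_head.
Qed.

Lemma cover_covers : {in nodes S, forall x, exists2 p, p \in cover B S & x \in nodes p}.
Proof.
have [cr [pm sub _] _] := cover_ledger B_ge3 S.
move=> x; rewrite (perm_mem pm) cat0s mem_cat => /orP [/sub|].
  by case/mapP => p pin ->; exists p; rewrite // nodes_root mem_head.
elim: (cover B S) => // [[a ts]] ps IH; rewrite fkids_cons fnodes_cat mem_cat.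
case/orP => [xts|/IH [p pin xp]].
  by exists (Node a ts); rewrite ?mem_head // nodesE inE xts orbT.
by exists p; rewrite // inE pin orbT.
Qed.

Lemma section_pruned t p : section t p -> exists d k, pruned d k [:: p] [:: t].
Proof.
case: t p => a ts [b ps] [l [m [r [d [k [/= -> -> pr _]]]]]].
have h := pruned_cat (pruned_drop_all l) (pruned_cat pr (pruned_drop_all r)).
by have := pruned_keep a h (pruned_nil _); rewrite /= cats0 => h'; do 2 eexists; exact: h'.
Qed.

Lemma section_uniq t : t \in subtrees S -> uniq (nodes t).
Proof. by move/(subtrees_induced uS)/finduced_uniq; rewrite !fnodes1; apply. Qed.

Lemma cover_induced : {in cover B S, forall p, induced_subtree p S}.
Proof.
move=> p /(cover_valid B_ge3) [_ [t tS /section_pruned [d [k pr]]]].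
apply/finduced1; apply: finduced_trans (subtrees_induced uS tS).
by apply: pruned_induced pr _; rewrite fnodes1 section_uniq.
Qed.

Lemma fsubtrees_mem t F x : t \in fsubtrees F -> x \in nodes t -> x \in fnodes F.
Proof.
elim/forest_ind: F => // a ts us IHts IHus.
rewrite fsubtrees_cons inE mem_cat fnodes_cons mem_cat.
case/or3P => [/eqP -> ->|/IHts h /h|/IHus h /h] //; last by move=> ->; rewrite orbT.
by rewrite nodesE inE => ->; rewrite orbT.
Qed.

Lemma subtree_children t x : t \in subtrees S -> x \in nodes t ->
  children S x = children t x.
Proof.
suff h F : uniq (fnodes F) -> t \in fsubtrees F -> x \in nodes t ->
  fchildren F x = children t x.
  move=> tS xt; rewrite -fchildren1; apply: h => //; rewrite ?fnodes1 //.
  by rewrite /fsubtrees /= cats0.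
elim/forest_ind: F => // a ts us IHts IHus uF.
have [u1 u2 ats aus dj] := uniq_fnodes_cons uF.
rewrite fsubtrees_cons inE mem_cat fchildren_cons => /or3P [/eqP ->|tts|tus] xt.
- rewrite (@fchildren_notin _ us) ?cats0 //.
  by move: xt; rewrite nodesE inE => /orP [/eqP ->|/dj].
- have xts := fsubtrees_mem tts xt.
  rewrite (@fchildren_notin _ us) ?dj // cats0 childrenE ifN ?IHts //.
  by apply: contraNneq ats => ->.
- have xus := fsubtrees_mem tus xt.
  rewrite childrenE ifN; last by apply: contraNneq aus => ->.
  by rewrite (@fchildren_notin _ ts) ?IHus //; apply/negP => /dj; rewrite xus.
Qed.

Lemma section_parts t p : t \in subtrees S -> section t p -> exists l m r d k,
  [/\ t = Node (root p) (l ++ m ++ r), uniq (nodes t), pruned d k (kids p) m,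
      d + k <= 1 & {subset fnodes (kids p) <= fnodes m}].
Proof.
move=> tS; have := section_uniq tS; case: t tS => a ts tS ut.
case=> [l [m [r [d [k [/= ets rp pr dk]]]]]]; exists l, m, r, d, k.
by split; rewrite ?rp -?ets //; exact: pruned_mem pr.
Qed.

Lemma fnodes_sections (l m r : seq (otree A)) : uniq (fnodes (l ++ m ++ r)) ->
  [/\ uniq (fnodes m), forall x, x \in fnodes m -> x \notin fnodes l &
      forall x, x \in fnodes m -> x \notin fnodes r].
Proof.
case/uniq_fnodes_cat => _ /uniq_fnodes_cat [um _ mr] lm; split=> // x xm.
by apply/negP => /lm; rewrite fnodes_cat mem_cat xm.
Qed.

(** Dropped children hang off the root of the piece and are exempt; only the cut proper subtrees
    count, and there is at most one. *)
Lemma cover_exits : {in cover B S, forall p x y x' y',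
  x \in nodes p -> x != root p -> y \notin nodes p -> edge S x y ->
  x' \in nodes p -> x' != root p -> y' \notin nodes p -> edge S x' y' ->
  (x, y) = (x', y')}.
Proof.
move=> p /(cover_valid B_ge3) [_ [t tS /(section_parts tS)]].
case=> l [m [r [d [k [et ut pr dk sub]]]]].
move: (ut); rewrite et nodesE /= => /andP [rnt /fnodes_sections [um ml mr]].
have [_ [E sE EP]] := pruned_exits pr um.
suff inE' x y : x \in nodes p -> x != root p -> y \notin nodes p -> edge S x y -> (x, y) \in E.
  move=> x y x' y' h1 h2 h3 h4 h1' h2' h3' h4'.
  have := inE' _ _ h1 h2 h3 h4; have := inE' _ _ h1' h2' h3' h4'.
  have: size E <= 1 by lia.
  by case: E {sE EP inE'} => [|e [|? ?]] //= _; rewrite !inE => /eqP -> /eqP ->.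
rewrite nodes_root !inE negb_or => /orP [/eqP ->|xp]; first by rewrite eqxx.
move=> nx /andP [_ yp]; rewrite /edge (@subtree_children t) //; last first.
  by rewrite et nodesE inE !fnodes_cat !mem_cat (sub x) ?orbT.
rewrite et childrenE eq_sym (negbTE nx) !fchildren_cat.
rewrite (@fchildren_notin _ l) ?ml ?sub // (@fchildren_notin _ r) ?mr ?sub //.
by rewrite cats0 /= => yx; exact: EP.
Qed.

(** A run can start only at the beginning or after a [false]. *)
Lemma blocks_bound b s : blocks b s <= ~~ b + count negb s.
Proof. by elim: s b => //= c s IH b; have := IH c; case: b c {IH} => [] [] /=; lia. Qed.

Lemma blocks_all_false s1 s2 : all negb s1 -> blocks false (s1 ++ s2) = blocks false s2.
Proof. by elim: s1 => //= -[] s1 IH //= /IH. Qed.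

Lemma blocks_none b s : all negb s -> blocks b s = 0.
Proof. by elim: s b => //= -[] s IH b //= /IH ->; rewrite andbF. Qed.

Lemma blocks_cat_false b s1 s2 : all negb s2 -> blocks b (s1 ++ s2) = blocks b s1.
Proof.
move=> h; elim: s1 b => [|c s1 IH] b /=; last by rewrite IH.
by rewrite blocks_none.
Qed.

(** The children outside the range of the section contribute only [false] at both ends; inside the
    range, the one child that may be dropped is the only separator. *)
Lemma cover_blocks : {in cover B S, forall p,
  blocks false [seq x \in nodes p | x <- children S (root p)] <= 2}.
Proof.
move=> p /(cover_valid B_ge3) [_ [t tS /(section_parts tS)]].
case=> l [m [r [d [k [et ut pr dk sub]]]]].
rewrite (@subtree_children t) //; last by rewrite et nodesE mem_head.
move: ut; rewrite et nodesE cons_uniq => /andP [rnt /fnodes_sections [um ml mr]].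
rewrite childrenE eqxx !map_cat.
have none G : {subset fnodes G <= fnodes (l ++ m ++ r)} ->
    (forall x, x \in fnodes m -> x \notin fnodes G) ->
    all negb [seq x \in nodes p | x <- map (@root A) G].
  move=> subG nG; apply/allP => _ /mapP [x xG ->]; have {}xG := roots_sub xG.
  rewrite nodes_root inE negb_or; apply/andP; split.
    by apply: contraNneq rnt => <-; exact: subG.
  by apply/negP => /sub /nG; rewrite xG.
rewrite blocks_all_false; last by apply: none => // x; rewrite fnodes_cat mem_cat => ->.
rewrite blocks_cat_false; last first.
  by apply: none => // x; rewrite !fnodes_cat !mem_cat => ->; rewrite !orbT.
apply: leq_trans (blocks_bound _ _) _; rewrite add1n ltnS count_map.
have [c _] := pruned_exits pr um; apply: leq_trans (_ : d <= 1); last by lia.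
apply: leq_trans c; apply: sub_count => x /=.
by rewrite nodes_root inE negb_or => /andP [].
Qed.

Lemma subtrees_height t : t \in subtrees S -> t = S \/ height t < height S.
Proof.
suff h F : t \in fsubtrees F -> height t < fheight F.
  case: S => a ts; rewrite subtreesE inE => /orP [/eqP|/h]; first by left.
  by right.
elim/forest_ind: F => // a ts us IHts IHus; rewrite fsubtrees_cons inE mem_cat.
rewrite /fheight /= -/(fheight us) leq_max ltnS -/(fheight ts).
case/or3P => [/eqP ->|/IHts /ltnW ->|/IHus ->]; rewrite ?orbT //.
by apply/orP; left; exact: leqnn.
Qed.

Lemma section_height t p : section t p -> height p <= height t.
Proof.
by case/section_pruned => d [k /pruned_height]; rewrite /fheight /= !maxn0 ltnS.
Qed.

End CoveringEq.

(** * Slabs *)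

Section Maps.
Variables (A A' : Type) (f : A -> A').

Lemma fnodes_map F : fnodes (map (otree_map f) F) = map f (fnodes F).
Proof.
elim/forest_ind: F => // a ts us IHts IHus.
by rewrite map_cons !fnodes_cons !nodesE map_cat IHus /= IHts.
Qed.

Lemma root_map t : root (otree_map f t) = f (root t). Proof. by case: t. Qed.

Lemma roots_map F : map (@root A') (map (otree_map f) F) = map f (map (@root A) F).
Proof. by elim: F => //= t F ->; rewrite root_map. Qed.

Lemma cut_map c t : cut c (otree_map f t) = otree_map f (cut c t).
Proof.
elim: c t => [|c IH] [a ts] //=; congr Node.
by rewrite -!map_comp; apply: eq_map => t /=; exact: IH.
Qed.

Lemma below_map c F : below c (map (otree_map f) F) = map (otree_map f) (below c F).
Proof.
elim: c F => //= c IH F; rewrite -IH; congr (below c _).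
by elim: F => // [[a ts]] F IHF; rewrite /= !fkids_cons IHF map_cat.
Qed.
End Maps.

(** * Bands of depths as truncated subforests *)

Section Bands.
Variable A : Type.
Implicit Types (t : otree A) (F : seq (otree A)).

Definition fband lo hi d F := flatten (map (@band A lo hi d) F).

Lemma band_in lo hi d F : lo <= d ->
  fband lo hi d F = if d <= hi then map (cut (hi - d)) F else [::].
Proof.
elim/forest_ind: F d => [|a ts us IHts IHus] d lod; first by rewrite if_same.
rewrite /fband /= -/(fband _ _ _ us) -/(fband _ _ _ ts) IHus // IHts 1?leqW // lod /=.
case: ltngtP => [dh|//|->]; last by rewrite subnn.
by rewrite subnS; case: (hi - d) (subn_gt0 d hi) => [|e] //=; rewrite dh.
Qed.

Lemma band_below e lo hi d F : lo = d + e -> lo <= hi ->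
  fband lo hi d F = map (cut (hi - lo)) (below e F).
Proof.
move=> -> {lo}; elim: e d F => [|e IH] d F h.
  by rewrite addn0 band_in // ?ifT //; lia.
have := IH d.+1 (fkids F); rewrite addSnnS => <- //.
elim: F => // [[a ts]] F IHF; rewrite fkids_cons.
rewrite {1}/fband /= -/(fband _ _ _ F) IHF ifF; last by lia.
by rewrite /fband map_cat flatten_cat.
Qed.

Lemma level_below t d : level t d = map (@root A) (below d [:: t]).
Proof.
have e := @band_below d d d 0 [:: t] (erefl _) (leqnn _).
rewrite /fband /= cats0 in e; rewrite /level e subnn.
by elim: (below d _) => //= u F ->.
Qed.

Lemma size_level t d : size (level t d) = size (below d [:: t]).
Proof. by rewrite level_below size_map. Qed.
End Bands.

Lemma cut_bottom (A : eqType) (F : seq (otree A)) c x : uniq (fnodes F) ->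
  x \in map (@root A) (below c F) -> fchildren (map (cut c) F) x = [::].
Proof.
elim/forest_ind: F c => // a ts us IHts IHus c uF.
have [u1 u2 ats aus dj] := uniq_fnodes_cons uF.
have sub F c' : uniq (fnodes F) -> x \in map (@root A) (below c' F) -> x \in fnodes F.
  by move=> uF' /roots_sub; apply: mem_subseq; case: (below_induced c' uF').
have subc F c' : {subset fnodes (map (cut c') F) <= fnodes F}.
  by have [k /pruned_mem] := pruned_cut c' F.
rewrite below_cons map_cat mem_cat map_cons fchildren_cons.
case: c => [|c].
  move=> _; rewrite /cut childrenE if_same /=.
  by elim: (us) => //= t F IH; rewrite fchildren_cons IH childrenE if_same.
rewrite [cut _ _]/= childrenE => /orP [xts|xus].
  have xt := sub _ _ u1 xts; rewrite ifN ?IHts //.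
    by rewrite fchildren_notin //; apply/negP => /subc; apply/negP/dj.
  by apply: contraNneq ats => ->.
have xu := sub _ _ u2 xus; rewrite ifN ?IHus // ?cats0.
  by rewrite fchildren_notin //; apply/negP => /subc /dj; rewrite xu.
by apply: contraNneq aus => ->.
Qed.

Lemma sum_bool (J : Type) (a : pred J) s : \sum_(i <- s) a i = count a s.
Proof. by elim: s => [|i s IH]; rewrite ?big_nil // big_cons IH. Qed.

Lemma count_le1 (J : eqType) (a : pred J) s : uniq s ->
  {in s &, forall i j, a i -> a j -> i = j} -> count a s <= 1.
Proof.
move=> us h; rewrite -size_filter.
have := filter_uniq a us; have := mem_filter a; move=> /(_ _ s) mf.
case: (filter a s) mf => [|i [|j r]] // mf.
have := mf i; have := mf j; rewrite !inE !eqxx orbT => /esym/andP [aj js] /esym/andP [ai si].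
by rewrite /= (h i j) // inE eqxx.
Qed.

(** The depths [i.+1 + j * H] run through [1, ..., m * H] without repetition, so this is a sum over
    distinct levels. *)
Lemma sum_residues (A : Type) (T : otree A) H m :
  \sum_(i < H) \sum_(j < m) size (below (i.+1 + j * H) [:: T]) <= num_nodes T.
Proof.
pose w d := size (below d [:: T]); rewrite -/(w _).
have -> : \sum_(i < H) \sum_(j < m) w (i.+1 + j * H) = \sum_(d < m * H) w d.+1.
  elim: m => [|m IH].
    by rewrite mul0n big_ord0 big1 // => i _; rewrite big_ord0.
  rewrite mulSn addnC big_split_ord /= -IH -big_split.
  by apply: eq_bigr => i _; rewrite big_ord_recr /= addSn (addnC i).
have := sum_below (m * H).+1 [:: T].
by rewrite big_ord_recl fnodes1 /= => h; apply: leq_trans h; rewrite leq_addl.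
Qed.

Section Slabs.
Variables (T : otree nat) (H B o : nat).
Hypotheses (uT : uniq (nodes T)) (H_ge3 : 3 <= H) (H_lt_B : H < B).
Hypotheses (o_bounds : 0 < o <= H)
  (o_min : forall o', 0 < o' <= H -> snodes T H o <= snodes T H o').

Let n := num_nodes T.
Let T' := otree_map Some T.
Let S i := slab_tree T H o i.

Lemma B_ge3 : 3 <= B. Proof. by lia. Qed.

Definition tops i := below (i * H + o - H) [:: T].
(** Slab 0 starts at the root, as its nominal upper end [o - H] is not positive; it reaches down
    only [o] levels. *)
Definition thickness i := if i is 0 then o else H.

Lemma tops_succ i : tops i.+1 = below (thickness i) (tops i).
Proof. by rewrite /tops -belowD; congr below; case: i => /=; lia. Qed.

Lemma slab_forestE i : slab_forest T H o i = map (cut (thickness i)) (tops i).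
Proof.
have := @band_below _ (i * H + o - H) (i * H + o - H) (i * H + o) 0 [:: T] (erefl _) (leq_subr _ _).
rewrite /fband /= cats0 /slab_forest => ->; rewrite /tops; congr (map (cut _) _).
by case: i => /=; lia.
Qed.

Lemma slab_forest_nil i : slab_forest T H o i = [::] <-> tops i = [::].
Proof. by rewrite slab_forestE; case: (tops i). Qed.

Let F i := map (cut (thickness i)) (below (i * H + o - H) [:: T']).

Lemma slab_treeE i : S i = Node None (F i).
Proof.
rewrite /S /slab_tree slab_forestE /F /T' (@below_map _ _ _ _ [:: T]) -!map_comp; congr Node.
by apply: eq_map => t /=; rewrite cut_map.
Qed.

Lemma uniq_T' : uniq (nodes T').
Proof.
rewrite -fnodes1 (@fnodes_map _ _ _ [:: T]) map_inj_uniq ?fnodes1 //.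
by move=> x y [].
Qed.

Lemma F_induced i : finduced (F i) [:: T'].
Proof.
have u1 : uniq (fnodes [:: T']) by rewrite fnodes1 uniq_T'.
have h := below_induced (i * H + o - H) u1.
apply: finduced_trans (h); apply: cut_induced; exact: finduced_uniq h u1.
Qed.

Lemma None_notin_F i : None \notin fnodes (F i).
Proof.
have [/mem_subseq sub _] := F_induced i; apply/negP => /sub.
by rewrite (@fnodes_map _ _ _ [:: T]) => /mapP [].
Qed.

Lemma uniq_F i : uniq (fnodes (F i)).
Proof. by apply: finduced_uniq (F_induced i) _; rewrite fnodes1 uniq_T'. Qed.

Lemma uniq_S i : uniq (nodes (S i)).
Proof. by rewrite slab_treeE nodesE /= None_notin_F uniq_F. Qed.

(** The dummy root comes first in preorder, so a piece with another root lies entirely in the forest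
    below the dummy. *)
Lemma induced_pure p i : induced_subtree p (S i) -> root p <> None ->
  induced_subtree p T'.
Proof.
rewrite slab_treeE => -[s e] /eqP rp; apply/finduced1.
have sF : subseq (nodes p) (fnodes (F i)).
  by move: s; rewrite nodes_root nodesE /= (negbTE rp).
apply: finduced_trans (F_induced i); split; rewrite ?fnodes1 // => x y xp yp.
have := e x y xp yp; rewrite /edge fchildren1 childrenE ifN //.
apply: contraNneq (None_notin_F i) => ->; exact: (mem_subseq sF).
Qed.

Lemma induced_glued p i : induced_subtree p (S i) -> root p = None ->
  {in kids p, forall t, induced_subtree t T'}.
Proof.
rewrite slab_treeE; case: p => a ps [s e] /= ra t tp; rewrite {a}ra in s e.
have {}s : subseq (fnodes ps) (fnodes (F i)) by move: s; rewrite !nodesE /= ?eqxx.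
have sub := mem_subseq s; apply/finduced1.
have h : finduced ps (F i).
  split=> // x y xp yp; have nx : x != None.
    by apply: contraNneq (None_notin_F i) => <-; exact: sub.
  have := e x y; rewrite /edge !childrenE eq_sym (negbTE nx) !nodesE !inE xp yp !orbT.
  exact.
apply: finduced_trans (finduced_trans h (F_induced i)); apply: mem_induced => //.
exact: finduced_uniq h (uniq_F i).
Qed.

Definition slab_pieces i : seq piece :=
  if nilp (tops i) then [::]
  else if num_nodes (S i) <= B then [:: (i, false, S i)]
  else [seq (i, true, p) | p <- cover B (S i)].

(** No slab with index above [n] contains a node, so [n.+1] indices suffice. *)
Definition pieces : seq piece := flatten [seq slab_pieces i | i <- iota 0 n.+1].

Lemma tops_large i : n < i -> tops i = [::].
Proof.
move=> ni; apply: below_large; rewrite fnodes1.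
rewrite -/(num_nodes T) -/n; have : i <= i * H by rewrite leq_pmulr //; lia.
case: i ni => // i; rewrite mulSn => h1 h2; have : i <= i * H by rewrite leq_pmulr //; lia.
by lia.
Qed.

Lemma slab_of_piece i mu : mu \in slab_pieces i -> slab mu = i.
Proof.
rewrite /slab_pieces; case: ifP => // _; case: ifP => _.
  by rewrite inE => /eqP ->.
by case/mapP => p _ ->.
Qed.

Lemma filter_pieces i : [seq mu <- pieces | slab mu == i] = slab_pieces i.
Proof.
rewrite /pieces filter_flatten -map_comp.
have e j : filter (fun mu => slab mu == i) (slab_pieces j) =
    if j == i then slab_pieces i else [::].
  case: eqVneq => [->|nij].
    by apply/all_filterP/allP => mu /slab_of_piece ->.
  apply/eqP; rewrite -[_ == _]negbK -has_filter; apply/hasPn => mu /slab_of_piece ->.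
  exact: nij.
rewrite (eq_map (g := fun j => if j == i then slab_pieces i else [::])) //.
have [ni|ni] := leqP i n; last first.
  have -> : slab_pieces i = [::] by rewrite /slab_pieces tops_large.
  by elim: (iota _ _) => // j s /= ->; rewrite if_same.
have: i \in iota 0 n.+1 by rewrite mem_iota.
elim: (iota _ _) (iota_uniq 0 n.+1) => //= j s IH /andP [js us].
rewrite inE eq_sym; case: eqVneq => [ej _|_ /= /(IH us) -> //].
rewrite -[RHS]cats0; congr (_ ++ _); rewrite ej in js.
elim: s js {IH us} => //= k s IH; rewrite inE negb_or eq_sym => /andP [/negbTE -> /IH].
by [].
Qed.

Lemma mem_pieces mu : (mu \in pieces) = (mu \in slab_pieces (slab mu)).
Proof. by rewrite -filter_pieces mem_filter eqxx. Qed.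

Lemma uniq_slab_pieces i : uniq (slab_pieces i).
Proof.
rewrite /slab_pieces; case: ifP => // _; case: ifP => // _.
by rewrite map_inj_uniq ?cover_uniq ?uniq_S ?B_ge3 // => p q [].
Qed.

Lemma uniq_pieces : uniq pieces.
Proof.
apply: count_le1_uniq => mu.
have -> : count_mem mu pieces = count_mem mu (slab_pieces (slab mu)).
  rewrite -filter_pieces count_filter; apply: eq_count => nu /=.
  by case: eqVneq => // ->; rewrite eqxx.
by rewrite count_uniq_mem ?uniq_slab_pieces ?leq_b1.
Qed.

Lemma pieceP mu : mu \in pieces -> tops (slab mu) <> [::] /\
  if fat mu then B < num_nodes (S (slab mu)) /\ ptree mu \in cover B (S (slab mu))
  else num_nodes (S (slab mu)) <= B /\ ptree mu = S (slab mu).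
Proof.
rewrite mem_pieces; case: mu => -[i f] t; rewrite /slab /fat /ptree /= /slab_pieces.
case: nilP => // nt; case: leqP => hB; first by rewrite inE => /eqP [-> ->].
by case/mapP => p pin [-> ->].
Qed.

Lemma piece_induced mu : mu \in pieces -> induced_subtree (ptree mu) (S (slab mu)).
Proof.
move=> /pieceP [_]; case: (fat mu) => -[_]; first exact: (cover_induced B_ge3 (uniq_S _)).
by move=> ->; split.
Qed.

Lemma height_F i t : t \in F i -> height t <= H.
Proof.
by case/mapP => u _ ->; apply: leq_trans (height_cut _ _) _; case: i => /=; lia.
Qed.

Lemma fheight_leq (G : seq (otree (option nat))) h :
  (forall t, t \in G -> height t <= h) <-> fheight G <= h.+1.
Proof.
rewrite /fheight; elim: G => //= t G IH; rewrite geq_max ltnS -(rwP andP) -IH.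
split=> [hG|[h1 h2] u]; last by rewrite inE => /orP [/eqP ->|/h2].
by split=> [|u uG]; apply: hG; rewrite inE ?eqxx ?uG ?orbT.
Qed.

Lemma height_S i : height (S i) <= H.+1.
Proof. by rewrite slab_treeE; apply/fheight_leq; exact: height_F. Qed.

(** The slab tree has height at most [H + 1] because of the dummy. A piece rooted at the dummy loses
    one level on passing to its components; any other fat piece lies in a proper subtree, which is
    lower. *)
Lemma piece_height mu : mu \in pieces -> {in components mu, forall t, height t <= H}.
Proof.
move=> mupieces; rewrite /components /glued.
have hk : height (ptree mu) <= H.+1 -> {in kids (ptree mu), forall t, height t <= H}.
  by case: (ptree mu) => a ps /= /fheight_leq h t /h.
have [_] := pieceP mupieces; case: (fat mu) => -[_]; last first.
  move=> e; rewrite e in hk *; rewrite {1}/S /slab_tree /= ?eqxx.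
  by apply: hk; exact: height_S.
move=> /(cover_valid B_ge3) [_ [t tS sec]]; have hp := section_height sec.
case: (subtrees_height tS) => ht.
  case: ifP => [_|]; first by apply: hk; apply: leq_trans hp _; rewrite ht height_S.
  move: sec => [? [? [? [? [? [_ -> _ _]]]]]].
  by rewrite ht slab_treeE eqxx.
have {}hp : height (ptree mu) <= H.
  by rewrite -ltnS; apply: leq_trans (height_S (slab mu)); apply: leq_ltn_trans ht.
case: ifP => _ u; last by rewrite inE => /eqP ->.
by apply: hk; exact: leqW.
Qed.

Lemma piece_size mu : mu \in pieces -> num_nodes (ptree mu) <= 2 * B.
Proof.
move=> /pieceP [_]; case: (fat mu) => -[]; last by move=> h ->; lia.
by move=> _ /(cover_valid B_ge3) [].
Qed.

Lemma piece_fat_eq mu nu : mu \in pieces -> nu \in pieces ->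
  slab mu = slab nu -> fat mu = fat nu.
Proof.
move=> /pieceP [_] hm /pieceP [_] hn e; rewrite e in hm.
by case: (fat mu) (fat nu) hm hn => [] [] // [h1 _] [h2 _]; move: h1 h2; lia.
Qed.

Lemma piece_eq mu nu : mu \in pieces -> nu \in pieces ->
  slab mu = slab nu -> ptree mu = ptree nu -> mu = nu.
Proof.
move=> hm hn e1 e2; have := piece_fat_eq hm hn e1.
by case: mu nu e1 e2 {hm hn} => [[i f] t] [[j g] u]; rewrite /slab /ptree /fat /= => -> -> ->.
Qed.

Lemma mem_copies mu x : (x \in copies mu) = (x.1 == slab mu) && (x.2 \in nodes (ptree mu)).
Proof.
case: x => i v; rewrite /copies; apply/mapP/andP => /= [[y yin [-> ->]]|[/eqP -> h]] //.
by exists v.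
Qed.

(** A skinny slab is a single piece, so two pieces of one slab come from its cover. Every statement
    about pairs within a slab is reduced to the cover in this way. *)
Lemma piece_fat mu nu : mu \in pieces -> nu \in pieces -> mu != nu -> slab mu = slab nu ->
  [/\ ptree mu \in cover B (S (slab mu)), ptree nu \in cover B (S (slab mu)) &
      ptree mu != ptree nu].
Proof.
move=> hm hn ne e; have nt : ptree mu != ptree nu.
  by apply: contraNneq ne => /(piece_eq hm hn e) ->.
have ef := piece_fat_eq hm hn e.
move: (pieceP hm) (pieceP hn) nt; rewrite -ef -e; case: (fat mu) => -[_ [_ h1]] [_ [_ h2]] //.
by rewrite h1 h2 eqxx.
Qed.

Lemma pieces_disjoint : {in pieces &, forall mu nu, mu != nu ->
  forall x, x \in copies mu -> x \in copies nu -> shared_root mu nu x}.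
Proof.
move=> mu nu hm hn ne [i x]; rewrite !mem_copies /= => /andP [/eqP ei xm] /andP [/eqP ej xn].
have e : slab mu = slab nu by rewrite -ei -ej.
have [cm cn nt] := piece_fat hm hn ne e.
have [rm rn] := cover_disjoint B_ge3 (uniq_S _) cm cn nt xm xn.
by rewrite /shared_root /proot -ei -ej -rm -rn eqxx.
Qed.

(** A fat slab has more than [B] nodes, which absorbs the additive [B] of [size_cover] and turns 6
    into 7. *)
Lemma cover_size_le i : B < num_nodes (S i) ->
  size (cover B (S i)) * B <= 7 * num_nodes (S i).
Proof. by move=> h; apply: leq_trans (size_cover B_ge3 (S i)) _; rewrite (mulSn 6) addnC leq_add2r ltnW. Qed.

Lemma cover_size_ge i : num_nodes (S i) <= 2 * (size (cover B (S i)) * B).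
Proof.
have: num_nodes (S i) <= size (fnodes (cover B (S i))).
  apply: uniq_leq_size (uniq_S i) _ => x /(cover_covers B_ge3) [p pin xp].
  by apply/flattenP; exists (nodes p) => //; apply: map_f.
move/leq_trans; apply; have: {in cover B (S i), forall p, num_nodes p <= 2 * B}.
  by move=> p /(cover_valid B_ge3) [].
elim: (cover B (S i)) => // p ps IH h.
rewrite fnodes_cons size_cat [size (p :: ps)]/= (mulSn (size ps)) mulnDr.
apply: leq_add; first exact: h (mem_head _ _).
by apply: IH => q qin; rewrite h // inE qin orbT.
Qed.

Lemma pieces_slabbing C : 7 <= C -> slabbing C H B T o pieces.
Proof.
move=> C7; split=> //.
- exact: uniq_pieces.
- by move=> mu /pieceP [h _] /slab_forest_nil.
move=> i ni; have {}ni : tops i <> [::] by move/slab_forest_nil.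
rewrite -/(S i) filter_pieces /slab_pieces; case: nilP => // _.
case: leqP => hB //; split; first by rewrite all_map; apply/allP.
rewrite -map_comp map_id; split.
- by move=> p pin; split; [exact: (cover_induced B_ge3 (uniq_S i)) | case: (cover_valid B_ge3 pin)].
- exact: (cover_covers B_ge3).
- split; first by apply: leq_trans (cover_size_le hB) _; rewrite leq_mul2r C7 orbT.
  by apply: leq_trans (cover_size_ge i) _; rewrite leq_mul2r; apply/orP; right; lia.
- exact: (cover_disjoint B_ge3 (uniq_S i)).
- exact: (cover_exits B_ge3 (uniq_S i)).
Qed.

(** A non-root node of [p] has a parent inside [p], and parents in the slab tree are unique. *)
Lemma cover_edge_root i p x y : p \in cover B (S i) -> y \in nodes p ->
  edge (S i) x y -> y = root p \/ x \in nodes p.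
Proof.
move=> pin yp exy; have [->|ny] := eqVneq y (root p); [by left | right].
have [s e] := cover_induced B_ge3 (uniq_S i) pin.
have up : uniq (fnodes [:: p]) by rewrite fnodes1 (subseq_uniq s) ?uniq_S.
have [||z] := nonroot_parent up (y := y); rewrite ?fnodes1 // ?inE //.
rewrite fchildren1 => yz; have zp : z \in nodes p.
  by rewrite -fnodes1; apply: (@fchildren_parent _ _ _ y); rewrite fchildren1.
have: edge (S i) z y by rewrite -e.
rewrite /edge -fchildren1 => h; rewrite /edge -fchildren1 in exy.
by rewrite (fchildren_inj _ exy h) ?fnodes1 ?uniq_S.
Qed.

Lemma pieces_connected : {in pieces &, forall mu nu, mu != nu ->
  forall x y, x \in copies mu -> y \in copies nu -> connected T H o x y ->
  [\/ shared_root mu nu x, root_child T H o mu nu x y,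
      inner_child T H o mu nu x y | promotion T H o mu nu x y]}.
Proof.
move=> mu nu hm hn ne x y xm yn /or3P [/eqP exy|exy|oxy].
- by apply: Or41; apply: pieces_disjoint => //; rewrite exy.
- have xm' := xm; have yn' := yn; move: xm' yn' (exy).
  rewrite !mem_copies => /andP [/eqP ex xp] /andP [/eqP ey yp] /andP [/eqP e12 exy'].
  have e : slab mu = slab nu by rewrite -ex -ey.
  have [cm cn nt] := piece_fat hm hn ne e.
  rewrite ex in exy'.
  have [yr|xq] := cover_edge_root cn yp exy'.
    have yn0 : y == proot nu by rewrite /proot -yr -ey -surjective_pairing.
    have [x0|x0] := eqVneq x (proot mu).
      by apply: Or42; rewrite /root_child yn0 exy x0 eqxx.
    by apply: Or43; rewrite /inner_child yn0 exy xm x0.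
  apply: Or41; apply: pieces_disjoint => //.
  by rewrite mem_copies xq andbT ex e.
- by apply: Or44; rewrite /promotion xm yn oxy.
Qed.

Lemma pieces_blocks : {in pieces &, forall mu nu, mu != nu -> proot mu = proot nu ->
  root_blocks T H o mu <= 2}.
Proof.
move=> mu nu hm hn ne [e _]; have [cm cn nt] := piece_fat hm hn ne e.
exact: (cover_blocks B_ge3 (uniq_S _) cm).
Qed.

Lemma pieces_inner_child : {in pieces & &, forall mu nu nu', mu != nu -> mu != nu' ->
  forall x y x' y', inner_child T H o mu nu x y -> inner_child T H o mu nu' x' y' ->
  (x, y) = (x', y')}.
Proof.
move=> mu nu nu' hm hn hn' ne ne' x y x' y'.
have inner nu0 x0 y0 : nu0 \in pieces -> mu != nu0 -> inner_child T H o mu nu0 x0 y0 ->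
    [/\ x0.1 = slab mu /\ y0.1 = slab mu, ptree mu \in cover B (S (slab mu)),
     x0.2 \in nodes (ptree mu) /\ x0.2 != root (ptree mu), y0.2 \notin nodes (ptree mu)
     & edge (S (slab mu)) x0.2 y0.2].
  move=> h0 n0 /and4P [xm x0r /eqP yr /andP [/eqP e12 exy]].
  move: (xm); rewrite mem_copies => /andP [/eqP ex xp].
  have e : slab mu = slab nu0 by rewrite -ex e12 yr.
  have [cm cn nt] := piece_fat hm h0 n0 e.
  rewrite ex in exy; split=> //.
  - by rewrite -e12 ex.
  - by split=> //; apply: contraNneq x0r => h; rewrite /proot -ex -h -surjective_pairing.
  (* If the target were also in [mu], it would be a shared node and hence the root of [mu]; but it
     is a child of a node of [mu]. *)
  apply/negP => yp; have yq : y0.2 \in nodes (ptree nu0) by rewrite yr nodes_root mem_head.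
  have [ym _] := cover_disjoint B_ge3 (uniq_S _) cm cn nt yp yq.
  have [s es] := cover_induced B_ge3 (uniq_S _) cm.
  have up : uniq (fnodes [:: ptree mu]) by rewrite fnodes1 (subseq_uniq s) ?uniq_S.
  have := @fchildren_nonroot _ [:: ptree mu] x0.2 y0.2 up.
  rewrite fchildren1 -/(edge _ _ _) es // => /(_ exy).
  by rewrite inE ym eqxx.
move=> /(inner _ _ _ hn ne) [[ex ey] cm [xp nx] yp exy].
move=> /(inner _ _ _ hn' ne') [[ex' ey'] _ [xp' nx'] yp' exy'].
have [] := cover_exits B_ge3 (uniq_S _) cm xp nx yp exy xp' nx' yp' exy'.
by case: x x' y y' ex ex' ey ey' {xp nx yp exy xp' nx' yp' exy'} => [? ?] [? ?] [? ?] [? ?] /= -> -> -> -> -> ->.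
Qed.

(** * Counting s-nodes, pieces and promotions *)

Lemma snodesE o' : snodes T H o' = \sum_(j < n) size (below (o' + j * H) [:: T]).
Proof. by apply: eq_bigr => j _; rewrite size_level. Qed.

Lemma snodes_bound : snodes T H o * H <= n.
Proof.
have le : snodes T H o * H <= \sum_(i < H) snodes T H i.+1.
  rewrite mulnC -{1}(card_ord H) -sum_nat_const.
  by apply: leq_sum => i _; apply: o_min; rewrite ltn_ord.
apply: leq_trans le _; under eq_bigr do rewrite snodesE.
exact: sum_residues.
Qed.

Definition weight i := if nilp (tops i) then 0 else num_nodes (S i).

Lemma num_nodes_S i : num_nodes (S i) + size (fnodes (tops i.+1)) =
  (size (fnodes (tops i)) + size (tops i.+1)).+1.
Proof.
rewrite tops_succ -size_cut /S /slab_tree slab_forestE /num_nodes nodesE /=.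
by rewrite -/(fnodes _) fnodes_map size_map addSn.
Qed.

(** In the induction hypothesis the summand [size (tops j.+1)] cancels the level shared by slabs [j]
    and [j.+1]. The dummy root is paid for by the top level, which is nonempty whenever the weight
    is not 0. *)
Lemma sum_weight_from m j :
  \sum_(i <- iota j m) weight i + size (tops j) <= 3 * size (fnodes (tops j)).
Proof.
have shrink i : size (tops i) + size (fnodes (tops i.+1)) <= size (fnodes (tops i)).
  rewrite tops_succ [X in _ <= X]size_fnodes_fkids leq_add2l.
  have : 0 < thickness i by case: (i) => [|k] /=; lia.
  case: (thickness i) => // c _ /=; elim: c (fkids _) => //= c IH G.
  by apply: leq_trans (IH _) _; rewrite [X in _ <= X]size_fnodes_fkids leq_addl.
elim: m j => [|m IH] j; first by rewrite big_nil; have := shrink j; lia.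
have -> : iota j m.+1 = j :: iota j.+1 m by [].
rewrite big_cons; move: (IH j.+1); set w := \sum_(i <- _) _.
have := shrink j; have := num_nodes_S j; rewrite /weight.
by case: nilP => [->|]; [rewrite /=; lia | case: (tops j) => [//|t G] _; rewrite [size (t :: G)]/=; lia].
Qed.

Lemma sum_weight : \sum_(i <- iota 0 n.+1) weight i <= 3 * n.
Proof.
have e0 : tops 0 = [:: T] by rewrite /tops mul0n add0n (_ : o - H = 0) //; lia.
by have := sum_weight_from n.+1 0; rewrite e0 fnodes1 -/(num_nodes T) -/n; lia.
Qed.

Lemma slab_pieces_size i : size (slab_pieces i) * H <= ~~ nilp (tops i) * H + 7 * weight i.
Proof.
rewrite /slab_pieces /weight; case: nilP => // _; case: (leqP (num_nodes _)) => hB.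
  exact: (leq_addr _ (1 * H)).
rewrite size_map; apply: leq_trans (leq_addl _ _); apply: leq_trans (cover_size_le hB).
by rewrite leq_mul2l ltnW ?orbT.
Qed.

Lemma slab_pieces_fat i : count fat (slab_pieces i) * B <= 7 * weight i.
Proof.
rewrite /slab_pieces /weight; case: nilP => // _; case: (leqP (num_nodes _)) => hB //.
apply: leq_trans (cover_size_le hB); rewrite leq_mul2r; apply/orP; right.
by rewrite count_map; exact: count_size.
Qed.

(** Each nonempty slab other than the first has an s-node on its top level. *)
Lemma sum_nonempty : \sum_(i <- iota 0 n.+1) ~~ nilp (tops i) <= (snodes T H o).+1.
Proof.
rewrite /= big_cons -(addn1 (snodes _ _ _)) addnC leq_add ?leq_b1 //.
rewrite snodesE -(addn0 1) iotaDl big_map -{1}(subn0 n) -/(index_iota 0 n) big_mkord.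
apply: leq_sum => j _; rewrite /tops.
have -> : (1 + j) * H + o - H = o + j * H by lia.
by case: (below _ _).
Qed.

Lemma size_flatten_sum (K : Type) (f : nat -> seq K) s :
  size (flatten (map f s)) = \sum_(i <- s) size (f i).
Proof. by elim: s => [|i s IH]; rewrite ?big_nil // big_cons -IH /= size_cat. Qed.

Lemma count_flatten_sum (J K : Type) (a : pred K) (f : J -> seq K) s :
  count a (flatten (map f s)) = \sum_(i <- s) count a (f i).
Proof. by elim: s => [|i s IH]; rewrite ?big_nil // big_cons -IH /= count_cat. Qed.

(** The constant is [22 = 1 + 7 * 3]: the s-nodes contribute [n], the weights at most [3 * n] with 7
    each. The summand [H] stands for the first slab. *)
Lemma pieces_size : size pieces * H <= H + 22 * n.
Proof.
rewrite size_flatten_sum big_distrl; set r := iota 0 n.+1.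
have h1 := sum_nonempty; have h2 := sum_weight; have h3 := snodes_bound.
rewrite -/r in h1 h2.
apply: (@leq_trans ((\sum_(i <- r) ~~ nilp (tops i)) * H + 7 * \sum_(i <- r) weight i)).
  rewrite big_distrl big_distrr -big_split; apply: leq_sum => i _.
  exact: slab_pieces_size.
apply: leq_trans (leq_add (leq_mul h1 (leqnn H)) (leq_mul (leqnn 7) h2)) _.
by rewrite mulSn; lia.
Qed.

Lemma pieces_fat_size : count fat pieces * B <= 21 * n.
Proof.
rewrite count_flatten_sum big_distrl; have := sum_weight; set r := iota 0 n.+1 => h.
apply: (@leq_trans (7 * \sum_(i <- r) weight i)); last by lia.
by rewrite big_distrr; apply: leq_sum => i _; exact: slab_pieces_fat.
Qed.

Lemma promoted_leaf x : promoted T H o x -> children (S x.1) x.2 = [::].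
Proof.
case: x => i [v|//].
change (v \in level T (i * H + o) -> children (S i) (Some v) = [::]).
rewrite level_below slab_treeE childrenE => hv; apply: cut_bottom.
  have u1 : uniq (fnodes [:: T']) by rewrite fnodes1 uniq_T'.
  exact: finduced_uniq (below_induced _ u1) u1.
rewrite -belowD (_ : _ + _ = i * H + o); last by case: (i) => /=; lia.
by rewrite (@below_map _ _ _ _ [:: T]) roots_map; exact: map_f.
Qed.

(** A promoted s-node is a leaf of its slab tree, so a piece rooted there is that node alone, and
    two pieces sharing it would be equal. *)
Lemma promoted_unique x : promoted T H o x ->
  {in pieces &, forall mu nu, x \in copies mu -> x \in copies nu -> mu = nu}.
Proof.
move=> px mu nu hm hn xm xn; apply/eqP; apply: contraT => ne.
have /andP [/eqP em /eqP en] := pieces_disjoint hm hn ne xm xn.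
have e : slab mu = slab nu by move: em; rewrite en => -[].
have [cm cn nt] := piece_fat hm hn ne e.
have leaf lam : lam \in pieces -> x = proot lam -> ptree lam = Node x.2 [::].
  move=> hl xl; have [_ ind] := piece_induced hl; have lf := promoted_leaf px.
  rewrite xl [_.1]/= [_.2]/= in lf *; move: (S (slab lam)) ind lf => Sl.
  case: (ptree lam) => a [|[b ts] us] // ind lf; set p := Node a _ in ind.
  have ap : a \in nodes p by rewrite nodesE mem_head.
  have bp : b \in nodes p by rewrite nodesE inE fnodes_cons mem_cat nodesE mem_head orbT.
  by have := ind a b ap bp; rewrite /edge lf childrenE eqxx inE eqxx.
by move: nt; rewrite (leaf mu) // (leaf nu) // eqxx.
Qed.

Definition marked := [seq x <- flatten (map copies pieces) | promoted T H o x].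

Lemma uniq_copies mu : mu \in pieces -> uniq (copies mu).
Proof.
move=> /piece_induced [s _]; rewrite map_inj_uniq ?(subseq_uniq s) ?uniq_S //.
by move=> x y [].
Qed.

Lemma marked_uniq : uniq marked.
Proof.
apply: count_le1_uniq => x; rewrite count_filter.
have [px|px] := boolP (promoted T H o x); last first.
  rewrite (eq_count (a2 := pred0)) ?count_pred0 // => y /=.
  by case: eqVneq => //= ->; rewrite (negbTE px).
apply: (@leq_trans (count_mem x (flatten (map copies pieces)))).
  by apply: sub_count => y /= /andP [].
rewrite count_flatten_sum.
have -> : \sum_(mu <- pieces) count_mem x (copies mu) = count (fun mu => x \in copies mu) pieces.
  rewrite -sum_bool; apply: eq_big_seq => mu hm.
  by rewrite count_uniq_mem ?uniq_copies.
apply: count_le1; [exact: uniq_pieces | exact: promoted_unique].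
Qed.

Lemma size_marked : size marked <= snodes T H o.
Proof.
pose l := flatten [seq [seq (j, Some v) | v <- level T (o + j * H)] | j <- iota 0 n].
have -> : snodes T H o = size l.
  rewrite /l size_flatten_sum -{1}(subn0 n) -/(index_iota 0 n) big_mkord.
  by apply: eq_bigr => j _; rewrite size_map.
apply: uniq_leq_size marked_uniq _ => -[i x]; rewrite mem_filter => /andP [].
case: x => // v; rewrite /promoted /= addnC => hv _.
apply/flattenP; eexists; last by apply: (map_f (fun v => (i, Some v))); exact: hv.
apply: (map_f (fun j => [seq (j, Some v) | v <- level T (o + j * H)])).
rewrite mem_iota /= add0n ltnNge; apply/negP => ni.
move: hv; rewrite level_below below_large // fnodes1 -/(num_nodes T) -/n.
have: i <= i * H by rewrite leq_pmulr //; lia.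
by lia.
Qed.

Definition next_copy (x : copy) : copy := (x.1.+1, x.2).

Lemma promotionsE : promotions T H o pieces =
  \sum_(nu <- pieces) count (fun x => next_copy x \in copies nu) marked.
Proof.
rewrite /promotions exchange_big; apply: eq_bigr => nu _.
rewrite count_filter count_flatten_sum; apply: eq_bigr => mu _.
apply: eq_in_count => x xm; rewrite /promotion /original_of xm eqxx andbT /=.
by [].
Qed.

(** Connections into the root of [nu] are charged to [nu]: only one promoted copy has this original.
    Any other original is a non-root node, lies in a single piece by disjointness, and is charged to
    its promoted copy. *)
Lemma promotions_bound : promotions T H o pieces <= size pieces + size marked.
Proof.
rewrite promotionsE.
pose inner (nu : piece) y := (y \in copies nu) && (y != proot nu).
apply: (@leq_trans (\sum_(nu <- pieces) (1 + count (fun x => inner nu (next_copy x)) marked))).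
  apply: leq_sum => nu _.
  pose a1 x := next_copy x == proot nu; pose a2 x := inner nu (next_copy x).
  apply: (@leq_trans (count (predU a1 a2) marked)).
    apply: sub_count => x /=; rewrite /a1 /a2 /inner => ->.
    by case: eqVneq.
  apply: leq_trans (leq_addr (count (predI a1 a2) marked) _) _.
  rewrite count_predUI leq_add2r; apply: count_le1; first exact: marked_uniq.
  by move=> [i x] [j y] _ _ /eqP hx /eqP; rewrite -hx => -[-> ->].
rewrite big_split /= sum1_size leq_add2l.
under eq_bigr do rewrite -sum_bool.
rewrite exchange_big /= -sum1_size; apply: leq_sum => x _.
rewrite (sum_bool (fun nu => inner nu (next_copy x))); apply: count_le1.
  exact: uniq_pieces.
move=> mu nu hm hn /andP [xm rm] /andP [xn rn]; apply/eqP; apply: contraT => ne.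
by have /andP [/eqP e _] := pieces_disjoint hm hn ne xm xn; rewrite e eqxx in rm.
Qed.

Lemma promotions_size : promotions T H o pieces * H <= 24 * n.
Proof.
(* Without s-nodes there are no promotions. Otherwise [H] is at most [snodes T H o * H], hence at
   most [n], which absorbs the additive [H] of [pieces_size]: [24 = 22 + 1 + 1]. *)
have [s0|s0] := posnP (snodes T H o).
  have := size_marked; rewrite s0 leqn0 => /nilP m0.
  by rewrite promotionsE m0 big1.
have := snodes_bound; have := size_marked; have := promotions_bound; have := pieces_size.
have : H <= snodes T H o * H by rewrite leq_pmull.
move: (promotions _ _ _ _) (size marked) (size pieces) (snodes T H o) => p m d s.
move=> h1 h2 h3 h4 h5; apply: (@leq_trans ((d + s) * H)).
  by rewrite leq_mul2r; apply/orP; right; lia.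
by rewrite mulnDl; lia.
Qed.
End Slabs.

(** * The program *)

Section SymbolicExecution.
Variable P : program.

Definition takes f u v K :=
  exists2 k, eval P [:: u] (nth (ENum 0) P f) v k & k <= K.

(** [wp env e Q]: running [e] yields some [v] within some [K] steps such that
    [Q v K]. *)
Fixpoint wp (env : seq val) (e : exp) (Q : val -> nat -> Prop) : Prop :=
  match e with
  | EVar i => if drop i env is v :: _ then Q v 1 else False
  | ENum n => Q (Num n) 1
  | ESucc e1 => wp env e1 (fun u k => if u is Num n then Q (Num n.+1) k.+1 else False)
  | ESub e1 e2 => wp env e1 (fun u1 k1 => wp env e2 (fun u2 k2 =>
      match u1, u2 with
      | Num m, Num n => Q (Num (m - n)) (k1 + k2).+1
      | _, _ => False
      end))
  | EPair e1 e2 => wp env e1 (fun u1 k1 => wp env e2 (fun u2 k2 =>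
      Q (Pair u1 u2) (k1 + k2).+1))
  | EFst e1 => wp env e1 (fun u k => if u is Pair v _ then Q v k.+1 else False)
  | ESnd e1 => wp env e1 (fun u k => if u is Pair _ v then Q v k.+1 else False)
  | EIfz e0 e1 e2 => wp env e0 (fun u k =>
      if u is Num 0 then wp env e1 (fun v k1 => Q v (k + k1).+1)
      else wp env e2 (fun v k2 => Q v (k + k2).+1))
  | ELet e1 e2 => wp env e1 (fun u k1 =>
      wp (u :: env) e2 (fun v k2 => Q v (k1 + k2).+1))
  | ECall f e1 => wp env e1 (fun u k1 =>
      f < size P /\ exists v k2, takes f u v k2 /\ Q v (k1 + k2).+1)
  end.

Lemma wp_sound env e Q : wp env e Q ->
  exists v k K, [/\ eval P env e v k, k <= K & Q v K].
Proof.
elim: e env Q => [i|n|e IH|e1 IH1 e2 IH2|e1 IH1 e2 IH2|e IH|e IH|e0 IH0 e1 IH1 e2 IH2|e1 IH1 e2 IH2|f e IH] env Q /=.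
- case E: (drop i env) => [|v r] // q; have hi : i < size env.
    by rewrite ltnNge; apply/negP => /drop_oversize; rewrite E.
  have := eval_var P hi; rewrite -[i in nth _ _ i]addn0 -nth_drop E /= => ev.
  by exists v, 1, 1.
- by exists (Num n), 1, 1; split=> //; constructor.
- case/IH => -[n|v w] [k [K [ev le q]]] //.
  by exists (Num n.+1), k.+1, K.+1; split=> //; constructor.
- case/IH1 => v1 [k1 [K1 [ev1 le1 /IH2 [v2 [k2 [K2 [ev2 le2]]]]]]].
  case: v1 ev1 => [m|//] ev1; case: v2 ev2 => [n|//] ev2 q //.
  exists (Num (m - n)), (k1 + k2).+1, (K1 + K2).+1.
  split=> //; last by rewrite ltnS leq_add.
  by constructor.
- case/IH1 => v1 [k1 [K1 [ev1 le1 /IH2 [v2 [k2 [K2 [ev2 le2 q]]]]]]].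
  exists (Pair v1 v2), (k1 + k2).+1, (K1 + K2).+1.
  split=> //; last by rewrite ltnS leq_add.
  by constructor.
- case/IH => -[n|v w] [k [K [ev le q]]] //.
  by exists v, k.+1, K.+1; split=> //; apply: eval_fst ev.
- case/IH => -[n|v w] [k [K [ev le q]]] //.
  by exists w, k.+1, K.+1; split=> //; apply: eval_snd ev.
- case/IH0 => u [k0 [K0 [ev0 le0 q]]].
  have [eu|nu] : u = Num 0 \/ u <> Num 0.
    by case: (u) => [[|n]|v w]; [left | right | right].
    rewrite eu in ev0 q; case: (IH1 _ _ q) => v [k [K [ev le {}q]]].
    exists v, (k0 + k).+1, (K0 + K).+1; split=> //; last by rewrite ltnS leq_add.
    exact: eval_ifz_zero ev0 ev.
  have {}q : wp env e2 (fun v k2 => Q v (K0 + k2).+1) by case: u q nu {ev0} => [[|n]|].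
  case: (IH2 _ _ q) => v [k [K [ev le {}q]]].
  exists v, (k0 + k).+1, (K0 + K).+1; split=> //; last by rewrite ltnS leq_add.
  exact: eval_ifz_other ev0 nu ev.
- case/IH1 => u [k1 [K1 [ev1 le1 /IH2 [v [k2 [K2 [ev2 le2 q]]]]]]].
  exists v, (k1 + k2).+1, (K1 + K2).+1; split=> //; last by rewrite ltnS leq_add.
  exact: eval_let ev1 ev2.
- case/IH => u [k1 [K1 [ev1 le1 [hf [v [K2 [[k2 ev2 le2] q]]]]]]].
  exists v, (k1 + k2).+1, (K1 + K2).+1; split=> //; last by rewrite ltnS leq_add.
  exact: eval_call hf ev1 ev2.
Qed.

(** With a concrete body, [wp] simplifies to a chain of calls. Each is discharged by the
    specification of the callee, and what remains is arithmetic on step bounds. *)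
Lemma takes_wp f u v K :
  wp [:: u] (nth (ENum 0) P f) (fun v' K' => v' = v /\ K' <= K) -> takes f u v K.
Proof.
case/wp_sound => v' [k [K' [ev le [<- le']]]]; exists k => //.
exact: leq_trans le le'.
Qed.
End SymbolicExecution.

Notation "# i" := (EVar i) (at level 1, format "# i").

(** The layout of the parameter of each function is given by its lemma
    [takes_...] below. *)
Definition main_body :=
  ELet (EPair (EFst #0) (ENum 0))
 (ELet (ECall 1 (EPair #0 (ENum 0)))
 (ELet (ECall 2 (EPair #1 (ENum 0)))
 (ELet (ECall 3 (EPair #1 (EPair (EFst (ESnd #3)) #0)))
 (ELet (ECall 6 (EPair (ECall 5 (EPair #0 (ESnd #2)))
                       (EPair (ENum 0) (EPair (ENum 1) (ENum 1)))))
       (ECall 9 (EPair #4 (EPair #0 (EPair (ENum 0) (ESnd #5))))))))).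

Definition levels_body :=
  EIfz (EFst #0) (ESnd #0)
 (ELet (EIfz (ESnd #0) (EPair (ENum 0) (ENum 0)) (ESnd #0))
       (ECall 1 (EPair (ESnd (EFst #1))
          (EPair (ESucc (EFst #0))
                 (ECall 1 (EPair (ESnd (EFst (EFst #1))) (ESnd #0))))))).

Definition count_body :=
  EIfz (EFst #0) (ESnd #0)
       (ECall 2 (EPair (ESnd (EFst #0))
          (ECall 2 (EPair (ESnd (EFst (EFst #0))) (ESucc (ESnd #0)))))).

(** One counter per residue, but no more than there are levels: building [H] counters need not be
    linear in [n]. *)
Definition budgets_body :=
  EIfz (EFst #0) (ENum 0)
 (EIfz (EFst (ESnd #0)) (ENum 0)
       (EPair (ESnd (ESnd #0))
          (ECall 3 (EPair (ESnd (EFst #0))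
             (EPair (ESub (EFst (ESnd #0)) (ENum 1)) (ESnd (ESnd #0))))))).

Definition spend_body :=
  EIfz (EFst #0) #0
 (EIfz (ESnd #0) #0
 (ELet (ECall 4 (EPair (ESnd (EFst #0)) (ESnd (ESnd #0))))
       (EPair (EPair (ESub (EFst (EFst #1)) (EFst (ESnd #1))) (EFst #0)) (ESnd #0)))).

Definition spend_all_body :=
  EIfz (ESnd #0) (EFst #0) (ECall 5 (ECall 4 #0)).

Definition argmax_body :=
  EIfz (EFst #0) (EFst (ESnd (ESnd #0)))
 (ELet (ESnd (ESnd (ESnd #0)))
 (EIfz (ESub (EFst (EFst #1)) (EFst (ESnd #1)))
   (ECall 6 (EPair (ESnd (EFst #1))
      (EPair (EFst (ESnd #1)) (EPair (EFst (ESnd (ESnd #1))) (ESucc #0)))))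
   (ECall 6 (EPair (ESnd (EFst #1)) (EPair (EFst (EFst #1)) (EPair #0 (ESucc #0))))))).

(** The trees below the cut are passed on by reference in an accumulator, neither copied nor
    traversed, so the cost depends on the upper part alone. The increment of a label encodes
    [Some]. *)
Definition truncate_body :=
  EIfz (EFst #0) (EPair (ENum 0) (ESnd (ESnd #0)))
 (ELet (ECall 7 (EPair (ESnd (EFst #0)) (ESnd #0)))
 (EIfz (EFst (ESnd #1))
   (EPair (EPair (EPair (ESucc (EFst (EFst (EFst #1)))) (ENum 0)) (EFst #0))
          (EPair (EFst (EFst #1)) (ESnd #0)))
 (ELet (ECall 7 (EPair (ESnd (EFst (EFst #1)))
          (EPair (ESub (EFst (ESnd #1)) (ENum 1)) (ESnd #0))))
   (EPair (EPair (EPair (ESucc (EFst (EFst (EFst #2)))) (EFst #0)) (EFst #1))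
          (ESnd #0))))).

Definition emit i t acc := EPair (EPair i (EPair (ENum 1) t)) acc.
Definition st_acc s := EFst s.
Definition st_group s := EFst (ESnd s).
Definition st_room s := EFst (ESnd (ESnd s)).
Definition st_exits s := EFst (ESnd (ESnd (ESnd s))).
Definition st_closed s := ESnd (ESnd (ESnd (ESnd s))).
Definition mk_state acc g r e c := EPair acc (EPair g (EPair r (EPair e c))).

Definition scan_body :=
  let pv p := EFst (ESnd p) in
  let cfg p := ESnd (ESnd (ESnd p)) in
  let pB p := EFst (cfg p) in
  let pi p := ESnd (cfg p) in
  EIfz (EFst #0)
   (mk_state (EFst (ESnd (ESnd #0))) (ENum 0) (ESub (pB #0) (ENum 1)) (ENum 0) (ENum 0))
 (ELet (ECall 8 (EPair (ESnd (EFst #0)) (ESnd #0)))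
 (ELet (ECall 8 (EPair (ESnd (EFst (EFst #1)))
          (EPair (EFst (EFst (EFst #1))) (EPair (st_acc #0) (cfg #1)))))
 (* [#0]: the state of the first child; [#1]: the state after scanning its right
    siblings; [#2]: the parameter *)
 (ELet (EPair (EFst (EFst (EFst #2))) (st_group #0))
 (ELet (EIfz (st_closed #1) (st_acc #1) (emit (pi #3) #0 (st_acc #1)))
 (* This is [closed q || exits q]. Flags are 0 for false, so the first branch of each [EIfz] is the
    negative case. *)
 (ELet (EIfz (st_closed #2) (st_exits #2) (ENum 1))
 (ELet
   (EIfz (st_exits #4) (EPair #1 (ESnd #4))
   (EIfz #0 (EPair #1 (ESnd #4))
     (mk_state (EIfz (st_group #4) #1 (emit (pi #5) (EPair (pv #5) (st_group #4)) #1))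
        (ENum 0) (ESub (pB #5) (ENum 1)) (ENum 0) (ENum 1))))
 (EIfz (st_closed #4)
   (ELet (ESub (st_room #0) (ESub (pB #6) (st_room #4)))
   (EIfz #0
     (mk_state (emit (pi #7) (EPair (pv #7) (EPair #4 (st_group #1))) (st_acc #1))
        (ENum 0) (ESub (pB #7) (ENum 1)) (ENum 0) (ENum 1))
     (mk_state (st_acc #1) (EPair #4 (st_group #1)) #0
        (EIfz (st_exits #1) (st_exits #5) (ENum 1)) (st_closed #1))))
   (mk_state (st_acc #0) (st_group #0) (st_room #0) (ENum 1) (st_closed #0))))))))).

Definition slabs_body :=
  let pi p := EFst (ESnd (ESnd p)) in
  let pH p := EFst (ESnd (ESnd (ESnd p))) in
  let pB p := ESnd (ESnd (ESnd (ESnd p))) in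
  EIfz (EFst #0) (ENum 0)
 (ELet (ECall 7 (EPair (EFst #0) (EPair (EFst (ESnd #0)) (ENum 0))))
 (ELet (ECall 9 (EPair (ESnd #0) (EPair (pH #1)
          (EPair (ESucc (pi #1)) (EPair (pH #1) (pB #1))))))
 (* The count starts at 1 for the dummy root. *)
 (EIfz (ESub (ECall 2 (EPair (EFst #1) (ENum 1))) (pB #2))
   (EPair (EPair (pi #2) (EPair (ENum 0) (EPair (ENum 0) (EFst #1)))) #0)
 (ELet (ECall 8 (EPair (EFst #1) (EPair (ENum 0) (EPair #0 (EPair (pB #2) (pi #2))))))
   (emit (pi #3) (EPair (ENum 0) (st_group #0)) (st_acc #0)))))).

Definition prog : program :=
  [:: main_body; levels_body; count_body; budgets_body; spend_body;
      spend_all_body; argmax_body; truncate_body; scan_body; slabs_body].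

(** * Specification and cost of each function *)

Local Notation computes := (takes prog).

Definition enc_forest (A : Type) (enc : A -> nat) F :=
  enc_seq (map (enc_tree enc) F).

Definition enc_nats (l : seq nat) := enc_seq (map Num l).

Lemma size_fnodes_cons (A : Type) (a : A) ts us :
  size (fnodes (Node a ts :: us)) = (size (fnodes ts) + size (fnodes us)).+1.
Proof. by rewrite fnodes_cons nodesE size_cat. Qed.

Lemma takes_count (A : Type) (enc : A -> nat) F m :
  computes 2 (Pair (enc_forest enc F) (Num m)) (Num (size (fnodes F) + m))
    (30 * size (fnodes F) + 10).
Proof.
elim/forest_ind: F m => [|a ts us IHts IHus] m; first exact: takes_wp.
rewrite size_fnodes_cons; apply: takes_wp => /=.
split=> //; do 2 eexists; split; first exact: IHts.
split=> //; do 2 eexists; split; first exact: IHus.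
by split; [congr Num|]; lia.
Qed.

Fixpoint tally (A : Type) (t : otree A) (acc : seq nat) : seq nat :=
  let: Node _ ts := t in
  (head 0 acc).+1 :: foldl (fun l u => tally u l) (behead acc) ts.
Definition ftally (A : Type) (F : seq (otree A)) acc := foldl (fun l u => tally u l) acc F.

Lemma takes_levels F acc :
  computes 1 (Pair (enc_forest id F) (enc_nats acc)) (enc_nats (ftally F acc))
    (60 * size (fnodes F) + 10).
Proof.
elim/forest_ind: F acc => [|a ts us IHts IHus] acc; first exact: takes_wp.
rewrite size_fnodes_cons; apply: takes_wp => /=.
case: acc => [|l acc] /=.
  split=> //; do 2 eexists; split; first exact: (IHts [::]).
  split=> //; do 2 eexists; split; first exact: (IHus (1 :: ftally ts [::])).
  by split=> //; lia.
split=> //; do 2 eexists; split; first exact: (IHts acc).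
split=> //; do 2 eexists; split; first exact: (IHus (l.+1 :: ftally ts acc)).
by split=> //; lia.
Qed.

Lemma takes_budgets L H n :
  computes 3 (Pair (enc_nats L) (Pair (Num H) (Num n)))
    (enc_nats (nseq (minn (size L) H) n)) (40 * size L + 10).
Proof.
elim: L H => [|l L IH] H; first by apply: takes_wp; rewrite /= min0n.
case: H => [|H]; apply: takes_wp; first by rewrite minn0 /=; split=> //; lia.
rewrite minnSS /=; split=> //; do 2 eexists; split; first exact: IH.
by rewrite subn1 /=; split=> //; lia.
Qed.

Fixpoint spend (vec L : seq nat) : seq nat * seq nat :=
  match vec, L with
  | a :: vec', l :: L' => let r := spend vec' L' in (a - l :: r.1, r.2)
  | _, _ => (vec, L)
  end.

(** [m] is fuel: with a nonempty [vec], every round removes at least one entry of [L], so [size L]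
    rounds suffice. *)
Fixpoint spend_all m vec L :=
  if m is m'.+1 then
    if L is [::] then vec else let r := spend vec L in spend_all m' r.1 r.2
  else vec.

Lemma spend_rest vec L : (spend vec L).2 = drop (size vec) L.
Proof. by elim: vec L => [|a vec IH] [|l L] //=. Qed.

Lemma size_spend vec L : size (spend vec L).1 = size vec.
Proof. by elim: vec L => [|a vec IH] [|l L] //=; rewrite IH. Qed.

Lemma nth_spend vec L j : nth 0 (spend vec L).1 j = nth 0 vec j - nth 0 L j.
Proof.
elim: vec L j => [|a vec IH] [|l L] [|j] //=; rewrite ?nth_nil ?subn0 //.
Qed.

Lemma size_spend_all m vec L : size (spend_all m vec L) = size vec.
Proof. by elim: m vec L => //= m IH vec [|l L] //; rewrite IH size_spend. Qed.

Lemma nth_spend_all m vec L j : size L <= m -> 0 < size vec ->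
  nth 0 (spend_all m vec L) j =
  nth 0 vec j - \sum_(k < m) nth 0 L (j + k * size vec).
Proof.
elim: m vec L => [|m IH] vec L hL hv; first by rewrite big_ord0 subn0.
case: L hL => [|l L] hL.
  by rewrite big1 /= ?subn0 // => k _; rewrite nth_nil.
rewrite [LHS]/= IH ?size_spend ?spend_rest ?size_drop //; last first.
  by move: hL hv => /=; lia.
rewrite nth_spend big_ord_recl addn0 subnDA; congr (_ - _).
by apply: eq_bigr => k _; rewrite nth_drop /bump mulSn addnCA.
Qed.

Lemma takes_spend vec L :
  computes 4 (Pair (enc_nats vec) (enc_nats L))
    (Pair (enc_nats (spend vec L).1) (enc_nats (spend vec L).2))
    (30 * minn (size vec) (size L) + 10).
Proof.
elim: vec L => [|a vec IH] [|l L]; apply: takes_wp => //=.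
split=> //; do 2 eexists; split; first exact: IH.
by rewrite minnSS; split=> //; lia.
Qed.

Lemma takes_spend_all m vec L : size L <= m -> 0 < size vec ->
  computes 5 (Pair (enc_nats vec) (enc_nats L)) (enc_nats (spend_all m vec L))
    (60 * size L + 10).
Proof.
elim: m vec L => [|m IH] vec [|l L] // hL hv; try exact: takes_wp.
apply: takes_wp => /=; split=> //; do 2 eexists; split.
  exact: (takes_spend vec (l :: L)).
split=> //; do 2 eexists; split.
  apply: IH; rewrite ?size_spend // spend_rest size_drop.
  by move: hL hv => /=; lia.
split=> //; rewrite spend_rest size_drop /=; move: hv; lia.
Qed.

Fixpoint argmax vec best arg i :=
  if vec is a :: vec' then
    if a - best == 0 then argmax vec' best arg i.+1 else argmax vec' a i i.+1
  else arg.

Lemma argmaxP vec best arg i : exists M,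
  [/\ best <= M, forall j, nth 0 vec j <= M &
      argmax vec best arg i = arg /\ M = best \/
      exists j, [/\ j < size vec, argmax vec best arg i = i + j & M = nth 0 vec j]].
Proof.
elim: vec best arg i => [|a vec IH] best arg i /=.
  by exists best; split=> // [j|]; [rewrite nth_nil | left].
case: eqP => ha.
  have [M [hb hM hc]] := IH best arg i.+1; exists M; split=> //.
    by case=> [|j] /=; [apply: leq_trans hb; lia | exact: hM].
  case: hc => [|[j [hj -> eM]]]; [by left | right].
  by exists j.+1; split=> //; rewrite addSnnS.
have [M [hb hM hc]] := IH a i i.+1; exists M; split.
- by apply: leq_trans hb; lia.
- by case.
right; case: hc => [[-> eM]|[j [hj -> eM]]]; first by exists 0; rewrite addn0.
by exists j.+1; split=> //; rewrite addSnnS.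
Qed.

Lemma takes_argmax vec best arg i :
  computes 6 (Pair (enc_nats vec) (Pair (Num best) (Pair (Num arg) (Num i))))
    (Num (argmax vec best arg i)) (80 * size vec + 10).
Proof.
elim: vec best arg i => [|a vec IH] best arg i; apply: takes_wp => //=.
case: (a - best) => [|d] /=; split=> //; do 2 eexists; (split; first exact: IH);
  by split=> //; lia.
Qed.

Lemma takes_truncate F c R :
  computes 7 (Pair (enc_forest id F) (Pair (Num c) (enc_forest id R)))
    (Pair (enc_forest enc_option (map (otree_map Some) (map (cut c) F)))
          (enc_forest id (below c F ++ R)))
    (120 * size (fnodes (map (cut c) F)) + 20).
Proof.
elim/forest_ind: F c R => [|a ts us IHts IHus] c R.
  by rewrite below0; exact: takes_wp.
rewrite below_cons map_cons; have -> : cut c (Node a ts) =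
  Node a (if c is c'.+1 then map (cut c') ts else [::]) by case: c.
rewrite size_fnodes_cons -catA; have hus := IHus c R.
have {IHus} := IHts ^~ (below c us ++ R); move: (below c us ++ R) hus => R'.
move: (map (cut c) us) => us' hus {}IHts; apply: takes_wp => /=.
split=> //; do 2 eexists; split; first exact: hus.
case: c {hus} => [|c] /=; first by split=> //; lia.
split=> //; do 2 eexists; split; first by rewrite subn1 /=; exact: IHts.
by split=> //; lia.
Qed.

Definition enc_state (acc : seq piece) (s : state (option nat)) :=
  Pair (enc_output acc) (Pair (enc_forest enc_option (group s))
    (Pair (Num (room s)) (Pair (Num (exits s)) (Num (closed s))))).

Definition tag_pieces i (ps : seq (otree (option nat))) : seq piece :=
  [seq (i, true, p) | p <- ps].

Lemma takes_scan B i v F acc :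
  computes 8 (Pair (enc_forest enc_option F) (Pair (Num (enc_option v))
      (Pair (enc_output acc) (Pair (Num B) (Num i)))))
    (let s := scan B (Node v F) in enc_state (tag_pieces i (done s) ++ acc) s)
    (300 * size (fnodes F) + 50).
Proof.
elim/forest_ind: F v acc => [|a ts us IHts IHus] v acc.
  by apply: takes_wp; rewrite /= subn1.
rewrite size_fnodes_cons; apply: takes_wp => /=.
split=> //; do 2 eexists; split; first exact: IHus.
split=> //; do 2 eexists; split; first exact: IHts.
rewrite -[foldr _ _ us]/(scan B (Node v us)) -[foldr _ _ ts]/(scan B (Node a ts)).
case: (scan B (Node v us)) => ps g r e c; case: (scan B (Node a ts)) => ps' g' r' e' c'.
rewrite /scan_kid /= -?subn1.
case: c' => /=.
  by case: e; case: g => [|t g]; rewrite /= /tag_pieces /= ?map_cat -?catA /=; split=> //; lia.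
case: e => /=; case: e' => /=.
- case: g => [|t g] /=; case: (B - 1 - (B - r')) => [|d];
  by rewrite /= /tag_pieces /= ?map_cat -?catA /=; split=> //; lia.
- by case: (r - (B - r')) => [|d]; rewrite /= /tag_pieces /= ?map_cat -?catA /=; split=> //; lia.
- by case: (r - (B - r')) => [|d]; rewrite /= /tag_pieces /= ?map_cat -?catA /=; split=> //; lia.
- by case: (r - (B - r')) => [|d]; rewrite /= /tag_pieces /= ?map_cat -?catA /=; split=> //; lia.
Qed.

Lemma nth_ftally (A : Type) (F : seq (otree A)) acc d :
  nth 0 (ftally F acc) d = size (below d F) + nth 0 acc d.
Proof.
elim/forest_ind: F acc d => [|a ts us IHts IHus] acc d; first by rewrite below0.
rewrite below_cons size_cat [ftally _ _]/= -/(ftally us _) IHus.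
rewrite -[foldl _ _ ts]/(ftally ts (behead acc)).
case: d => [|d]; rewrite [nth _ (_ :: _) _]/=; last first.
  by rewrite IHts nth_behead; lia.
by rewrite -nth0 /=; lia.
Qed.

Lemma size_ftally (A : Type) (F : seq (otree A)) acc :
  size (ftally F acc) <= size acc + size (fnodes F).
Proof.
elim/forest_ind: F acc => [|a ts us IHts IHus] acc; first by rewrite /= addn0.
rewrite size_fnodes_cons [ftally _ _]/= -/(ftally us _).
apply: leq_trans (IHus _) _; rewrite -[foldl _ _ ts]/(ftally ts (behead acc)) /=.
by have := IHts (behead acc); rewrite size_behead; case: (acc) => [|l r] /=; lia.
Qed.

(** [behead] discards depth 0, so that the first counter belongs to offset 1. If all counters end at
    0, the initial answer 1 stands, and it is as good as any other. *)
Definition offset (T : otree nat) H :=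
  let L := ftally [:: T] [::] in
  argmax (spend_all (num_nodes T) (nseq (minn (size L) H) (num_nodes T)) (behead L)) 0 1 1.

Lemma offset_min T H : 0 < H -> 0 < offset T H <= H /\
  forall o', 0 < o' <= H -> snodes T H (offset T H) <= snodes T H o'.
Proof.
move=> H0; rewrite /offset; set L := ftally _ _; set n := num_nodes T.
pose w d := size (below d [:: T]).
have Lw d : nth 0 L d = w d by rewrite nth_ftally nth_nil addn0.
have n0 : 0 < n by rewrite /n /num_nodes nodes_root.
have Ln : size L <= n by apply: leq_trans (size_ftally _ _) _; rewrite fnodes1.
have L0 : 0 < size L.
  by have := Lw 0; case: (L) => //=; rewrite /w.
have w0 d : size L <= d -> w d = 0 by rewrite -Lw => h; rewrite nth_default.
set h := minn _ _; have h0 : 0 < h by rewrite leq_min L0.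
pose s j := \sum_(k < n) w (j.+1 + k * h).
set vec := spend_all _ _ _.
have vecE j : j < h -> nth 0 vec j = n - s j.
  move=> jh; rewrite /vec nth_spend_all ?size_nseq //; last first.
    by rewrite size_behead; lia.
  rewrite nth_nseq jh; congr (_ - _); apply: eq_bigr => k _.
  by rewrite nth_behead Lw addSn.
have sz : size vec = h by rewrite size_spend_all size_nseq.
(* No residue sum exceeds [n], so truncated subtraction from [n] reverses the order without loss. *)
have sn j : j < h -> s j <= n.
  move=> jh; apply: leq_trans (sum_residues T h n).
  by rewrite (bigD1 (Ordinal jh)) //= leq_addr.
have [M [_ hM hr]] := argmaxP vec 0 1 1.
have [j [jh -> eM]] : exists j, [/\ j < h, argmax vec 0 1 1 = j.+1 & M = nth 0 vec j].
  case: hr => [[e eM]|[j [hj e eM]]]; last by exists j; rewrite -sz e.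
  by exists 0; split=> //; apply/eqP; rewrite eqn_leq hM eM.
have best i : i < h -> s j <= s i.
  by move=> ih; have := hM i; rewrite eM !vecE //; have := sn j jh; lia.
split; first by rewrite /=; apply: leq_trans jh _; exact: geq_minr.
move=> o' /andP [o0 oH]; rewrite !snodesE -/n -!/(w _).
have [HL|LH] := leqP H (size L).
  have hH : h = H by rewrite /h; apply/minn_idPr.
  have := best o'.-1; rewrite /s hH prednK // => h'; apply: h'; lia.
(* With fewer levels than [H], the last counter collects only depths from [size L] on, which are
   empty, so the minimum is 0. The chosen depth is then empty as well, and adding a positive
   multiple of [H] leads below the tree. *)
have hL : h = size L by rewrite /h; apply/minn_idPl/ltnW.
have : s j = 0.
  apply/eqP; rewrite -leqn0; apply: leq_trans (best h.-1 _) _; first by rewrite prednK.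
  rewrite /s prednK // big1 // => k _; apply: w0; rewrite hL; lia.
move/eqP; rewrite /s sum_nat_eq0 => /forallP sj0.
rewrite big1 // => k _; case: k => -[|k] hk.
  by have := sj0 (Ordinal n0); rewrite mul0n addn0 => /eqP.
by apply: w0; rewrite mulSn; lia.
Qed.

Section Running.
Variables (T : otree nat) (H B o : nat).
Hypotheses (uT : uniq (nodes T)) (H_ge3 : 3 <= H) (H_lt_B : H < B).
Hypothesis o_bounds : 0 < o <= H.

Lemma slab_pieces_none m i : tops T H o i = [::] ->
  flatten [seq slab_pieces T H B o j | j <- iota i m] = [::].
Proof.
elim: m i => //= m IH i ti; rewrite {1}/slab_pieces ti /= IH //.
by rewrite (tops_succ uT H_ge3 H_lt_B o_bounds) ti below0.
Qed.

(** Truncating, counting and scanning a slab are linear in its weight; the dummy root included there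
    pays for the constant overhead. *)
Lemma takes_slabs m i : tops T H o (i + m) = [::] ->
  computes 9 (Pair (enc_forest id (tops T H o i)) (Pair (Num (thickness H o i))
      (Pair (Num i) (Pair (Num H) (Num B)))))
    (enc_output (flatten [seq slab_pieces T H B o j | j <- iota i m]))
    (600 * \sum_(j <- iota i m) weight T H o j + 10).
Proof.
elim: m i => [|m IH] i; first by rewrite addn0 => ->; apply: takes_wp => /=; split=> //; lia.
rewrite addnS -addSn => /IH hrest.
have [ti|ti] := nilP (T := otree nat) (s := tops T H o i).
  rewrite slab_pieces_none // ti; apply: takes_wp => /=; split=> //; lia.
have -> : iota i m.+1 = i :: iota i.+1 m by [].
rewrite big_cons map_cons [flatten _]/=.
move: hrest; set rest := flatten _; set wr := bigop _ _ _ => hrest.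
have htr := takes_truncate (tops T H o i) (thickness H o i) [::].
rewrite cats0 -(tops_succ uT H_ge3 H_lt_B o_bounds) in htr.
have sE : slab_tree T H o i =
    Node None (map (otree_map Some) (map (cut (thickness H o i)) (tops T H o i))).
  by rewrite /slab_tree (slab_forestE uT H_ge3 H_lt_B o_bounds).
have szE : size (fnodes (map (cut (thickness H o i)) (tops T H o i))) =
    size (fnodes (map (otree_map Some) (map (cut (thickness H o i)) (tops T H o i)))).
  by rewrite fnodes_map size_map.
rewrite /slab_pieces /weight sE; rewrite szE in htr.
rewrite (_ : nilp (tops T H o i) = false); last exact/nilP.
move: (map (otree_map Some) _) htr {sE szE} => Fs htr.
have nE : num_nodes (Node None Fs) = (size (fnodes Fs)).+1 by rewrite /num_nodes nodesE.
rewrite !nE; have hcount := takes_count enc_option Fs 1.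
have hscan := takes_scan B i None Fs rest.
case Et: (tops T H o i) ti htr => [|t G] // _ htr.
apply: takes_wp => /=.
split=> //; do 2 eexists; split; first exact: htr.
split=> //; do 2 eexists; split; first exact: hrest.
split=> //; do 2 eexists; split; first exact: hcount.
rewrite /= addn1 -subn_eq0; case: (_ - B) => [|d]; rewrite [_ == _]/=.
  by split=> //; lia.
rewrite /=; split=> //; do 2 eexists; split; first exact: hscan.
rewrite /= -/(tag_pieces i _); split; last by lia.
by [].
Qed.
End Running.

(** The slabs take [600 * 3 * n] steps by [sum_weight], the search for the offset about [270 * n];
    additive constants are absorbed because [n] is positive. *)
Lemma prog_runs T H B : uniq (nodes T) -> 3 <= H -> H < B -> exists2 k,
  runs prog (enc_input T H B) (enc_output (pieces T H B (offset T H))) k &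
  k <= 3000 * num_nodes T.
Proof.
move=> uT H_ge3 H_lt_B; have [o_bounds _] := offset_min T (ltnW (ltnW H_ge3)).
have tl := tops_large uT H_ge3 H_lt_B o_bounds (ltnSn (num_nodes T)).
have hslabs := @takes_slabs T H B _ uT H_ge3 H_lt_B o_bounds (num_nodes T).+1 0 tl.
have hw := sum_weight uT H_ge3 H_lt_B o_bounds.
have e0 : tops T H (offset T H) 0 = [:: T].
  by rewrite /tops mul0n add0n (_ : _ - H = 0) //; lia.
rewrite e0 in hslabs.
move: hslabs hw; rewrite -/(pieces _ _ _ _); set W := bigop _ _ _ => hslabs hw.
have n0 : 0 < num_nodes T by rewrite /num_nodes nodes_root.
have [k ev le] : computes 0 (enc_input T H B)
    (enc_output (pieces T H B (offset T H))) (2900 * num_nodes T).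
  have hlev := takes_levels [:: T] [::]; have hcnt := takes_count id [:: T] 0.
  have szL := size_ftally [:: T] [::]; have := erefl (offset T H).
  rewrite {2}/offset; move: hlev szL; rewrite add0n.
  have : 0 < size (ftally [:: T] [::]).
    have := nth_ftally [:: T] [::] 0; by case: (ftally _ _).
  case: (ftally _ _) => // l L _ hlev szL oE.
  have hbud := takes_budgets (l :: L) H (num_nodes T).
  rewrite fnodes1 -/(num_nodes T) ?addn0 in hlev hcnt szL.
  have hsp : computes 5 (Pair (enc_nats (nseq (minn (size (l :: L)) H) (num_nodes T)))
      (enc_nats L)) (enc_nats (spend_all (num_nodes T)
      (nseq (minn (size (l :: L)) H) (num_nodes T)) L)) (60 * size L + 10).
    apply: takes_spend_all; first by move: szL => /=; lia.
    by rewrite size_nseq leq_min /=; lia.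
  have := takes_argmax (spend_all (num_nodes T)
    (nseq (minn (size (l :: L)) H) (num_nodes T)) L) 0 1 1.
  rewrite -oE size_spend_all size_nseq => harg.
  have mL := geq_minl (size (l :: L)) H.
  move: hbud hsp harg mL; set h := minn _ _; set vec := nseq _ _ => hbud hsp harg mL.
  apply: takes_wp => /=.
  split=> //; do 2 eexists; split; first exact: hlev.
  split=> //; do 2 eexists; split; first exact: hcnt.
  split=> //; do 2 eexists; split; first exact: hbud.
  split=> //; do 2 eexists; split; first exact: hsp.
  split=> //; do 2 eexists; split; first exact: harg.
  split=> //; do 2 eexists; split; first exact: hslabs.
  by split=> //; move: szL mL => /=; lia.
exists (1 + k).+1; last by lia.
apply: (@eval_call prog [:: enc_input T H B] 0 (EVar 0) (enc_input T H B) _ 1 k) => //.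
exact: (@eval_var prog [:: enc_input T H B] 0).
Qed.

Theorem theorem3 :
  exists (P : program) (C : nat),
  forall (T : otree nat) (H B : nat),
  uniq (nodes T) -> 3 <= H -> H < B ->
  let n := num_nodes T in
  exists (o : nat) (D : seq piece) (k : nat),
    (* linear time *)
    (runs P (enc_input T H B) (enc_output D) k /\ k <= C * n) /\
    (* via tree slabbing *)
    slabbing C H B T o D /\
    (* (i) *)
    {in D &, forall mu nu, mu != nu ->
       forall x, x \in copies mu -> x \in copies nu -> shared_root mu nu x} /\
    (* (ii); the dummy root counts for the size but not for the height *)
    {in D, forall mu, num_nodes (ptree mu) <= 2 * B /\
       {in components mu, forall t, height t <= H}} /\
    (* (iii): pure, or glued *)
    {in D, forall mu,
       (~~ glued mu /\ induced_subtree (ptree mu) (otree_map Some T)) \/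
       (glued mu /\
        {in kids (ptree mu), forall t, induced_subtree t (otree_map Some T)})} /\
    (* (iv) *)
    {in D, forall mu,
       (~~ fat mu /\ ptree mu = slab_tree T H o (slab mu)) \/ fat mu} /\
    (* (v); maxn because there is still one subtree when n < H *)
    (size D * H <= C * maxn n H /\ count fat D * B <= C * n) /\
    (* (vi): every connection has one of the four types, ... *)
    {in D &, forall mu nu, mu != nu ->
       forall x y, x \in copies mu -> y \in copies nu ->
       connected T H o x y ->
       [\/ shared_root mu nu x,
           root_child T H o mu nu x y,
           inner_child T H o mu nu x y |
           promotion T H o mu nu x y]} /\
    (* ... with at most two blocks of children of a shared root, ... *)
    {in D &, forall mu nu, mu != nu -> proot mu = proot nu ->
       root_blocks T H o mu <= 2} /\
    (* ... at most one edge from a non-root node per subtree, ... *)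
    {in D & &, forall mu nu nu', mu != nu -> mu != nu' ->
       forall x y x' y',
       inner_child T H o mu nu x y -> inner_child T H o mu nu' x' y' ->
       (x, y) = (x', y')} /\
    (* ... and O(n/H) connections of the last type *)
    promotions T H o D * H <= C * n.
Proof.
(* The constant of the running time also exceeds those of all the counting bounds. *)
exists prog, 3000 => T H B uT H_ge3 H_lt_B n.
have [ob omin] := offset_min T (ltnW (ltnW H_ge3)).
set o := offset T H in ob omin *; pose D := pieces T H B o.
have [k hk kC] := prog_runs uT H_ge3 H_lt_B.
exists o, D, k; split=> //; split; first exact: pieces_slabbing.
split; first exact: (pieces_disjoint uT H_ge3 H_lt_B ob).
split.
  move=> mu hmu; split; first exact: (piece_size uT H_ge3 H_lt_B ob hmu).
  exact: (piece_height uT H_ge3 H_lt_B ob hmu).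
split.
  move=> mu hmu; have ind := piece_induced uT H_ge3 H_lt_B ob hmu.
  rewrite /glued; case: eqP => r; [right | left]; split=> //.
    exact: (induced_glued uT H_ge3 H_lt_B ob ind r).
  exact: (induced_pure uT H_ge3 H_lt_B ob ind r).
split.
  move=> mu /(pieceP uT H_ge3 H_lt_B ob) [_].
  by case: (fat mu) => -[_ h]; [right | left].
split.
  have h1 := pieces_size uT H_ge3 H_lt_B ob omin.
  have h2 := pieces_fat_size uT H_ge3 H_lt_B ob.
  split; last by apply: leq_trans h2 _; rewrite leq_mul2r orbT.
  apply: leq_trans h1 _; rewrite -/n; have := leq_maxl n H; have := leq_maxr n H; lia.
split; first exact: (pieces_connected uT H_ge3 H_lt_B ob).
split; first exact: (pieces_blocks uT H_ge3 H_lt_B ob).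
split; first exact: (pieces_inner_child uT H_ge3 H_lt_B ob).
have h := promotions_size uT H_ge3 H_lt_B ob omin.
by apply: leq_trans h _; rewrite leq_mul2r orbT.
Qed.
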